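(* Let $K=\mathbb{Q}(\sqrt3)$, $\varepsilon=2+\sqrt3$, and $\mathcal{C}=\{1,\ \varepsilon,\ 4\pm\sqrt3,\ \varepsilon(4\pm\sqrt3),\ 7\pm2\sqrt3,\ \varepsilon(7\pm2\sqrt3)\}$ (understood as a set of 10 classes modulo squares of units). Then: (1) $\mathcal{C}\subset\mathcal{C}^{\mathrm{diag}}_K\subset\mathcal{C}^{\mathrm{cl}}_K$. (2) $\mathcal{C}^{\mathrm{cl}}_K$ contains no other element with norm below $250\,000$. (3) $\mathcal{C}$ is the (minimal) $S$-criterion set for classical lattices, where $S=\{\alpha\in\mathbb{Z}[\sqrt3]^+\mid \mathrm N(\alpha)\le250\,000\}$. (4) Assume both of the following: (A) the lattice $\langle1,\varepsilon,1+\varepsilon\rangle$ represents (modulo squares of units) all of $\mathbb{Z}[\sqrt3]^+$ except for $2+\overline\varepsilon$, $1+2\overline\varepsilon$, $2+3\varepsilon$ and $3+2\varepsilon$; (B) for each $a\in\{0,1,2,\sqrt3,1+\sqrt3\}$ the lattice $\langle1,\varepsilon\rangle\perp\left\langle\begin{smallmatrix} 2+\varepsilon & a \\ a & 2+\overline\varepsilon \end{smallmatrix}\right\rangle$ represents (modulo squares of units) all of $\mathbb{Z}[\sqrt3]^+$ except possibly for the nine elements $5\pm2\sqrt3,\ 8\pm2\sqrt3,\ 15\pm7\sqrt3,\ 15\pm6\sqrt3,\ 13$. Then $\mathcal{C}^{\mathrm{cl}}_K=\mathcal{C}^{\mathrm{diag}}_K=\mathcal{C}$.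
   Context: $K=\mathbb{Q}(\sqrt3)$, $\mathcal{O}_K=\mathbb{Z}[\sqrt3]$, $\mathbb{Z}[\sqrt3]^+$ is the set of totally positive elements, $\mathcal{U}_K^2=\{\varepsilon^{2k}\}$ is the group of squares of units, $\mathrm N$ the norm, $\overline{\alpha}$ the conjugate of $\alpha$. All lattices are classical: a lattice is a finitely generated torsion-free $\mathcal{O}_K$-module $L$ with a quadratic map $Q:L\to\mathcal{O}_K$ whose bilinear form $B_Q(v,w)=\frac12(Q(v+w)-Q(v)-Q(w))$ takes values in $\mathcal{O}_K$ and with $Q(v)$ totally positive for all $v\neq0$. $L$ represents $\alpha$ if $Q(v)=\alpha$ for some $v\in L$; this depends only on $\alpha\,\mathcal{U}_K^2$, and elements of $\mathbb{Z}[\sqrt3]^+$ are identified with their classes in $\mathbb{Z}[\sqrt3]^+/\mathcal{U}_K^2$. $L$ is $S$-universal if it represents all elements of $S$. For a totally positive definite symmetric matrix $G$ over $\mathcal{O}_K$, $\langle G\rangle$ is the lattice having a basis with Gram matrix $G$ (entries $B_Q(v_i,v_j)$); $\langle\alpha_1,\dots,\alpha_n\rangle$ is the diagonal case (a diagonal lattice); $\perp$ is orthogonal sum. For $S\subset\mathbb{Z}[\sqrt3]^+/\mathcal{U}_K^2$, a subset $\mathcal{C}'\subset S$ is an $S$-criterion set for classical (resp. diagonal) lattices if every classical (resp. diagonal) lattice is $S$-universal if and only if it is $\mathcal{C}'$-universal. There is a unique minimal one, $\mathcal{C}_S^{\mathrm{cl}}$ (resp. $\mathcal{C}_S^{\mathrm{diag}}$),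 consisting precisely of the elements $\alpha\in S$ for which some classical (resp. diagonal) lattice represents all of $S$ except $\alpha$. For $S=\mathbb{Z}[\sqrt3]^+/\mathcal{U}_K^2$ these sets are denoted $\mathcal{C}^{\mathrm{cl}}_K$ and $\mathcal{C}^{\mathrm{diag}}_K$. *)

(* Defs.v *)
From HB Require Import structures.
From mathcomp Require Import all_boot all_order all_algebra all_field.
From mathcomp Require Import ring.
From mathcomp Require Import boolp classical_sets.

Set Implicit Arguments.
Unset Strict Implicit.
Unset Printing Implicit Defensive.

Import Order.TTheory GRing.Theory Num.Theory.

Local Open Scope ring_scope.
Local Open Scope classical_set_scope.

(* [ZSqrt3 a b] is a + b sqrt 3. *)
Record zsqrt3 : Type := ZSqrt3 { ratp : int; irrp : int }.

Definition zsqrt3_pair (x : zsqrt3) : int * int := (ratp x, irrp x).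
Definition pair_zsqrt3 (p : int * int) : zsqrt3 := ZSqrt3 p.1 p.2.

Lemma zsqrt3_pairK : cancel zsqrt3_pair pair_zsqrt3.
Proof. by case. Qed.

HB.instance Definition _ := Countable.copy zsqrt3 (can_type zsqrt3_pairK).

Definition z3_zero : zsqrt3 := ZSqrt3 0 0.
Definition z3_one : zsqrt3 := ZSqrt3 1 0.
Definition z3_opp (x : zsqrt3) : zsqrt3 := ZSqrt3 (- ratp x) (- irrp x).
Definition z3_add (x y : zsqrt3) : zsqrt3 :=
  ZSqrt3 (ratp x + ratp y) (irrp x + irrp y).
Definition z3_mul (x y : zsqrt3) : zsqrt3 :=
  ZSqrt3 (ratp x * ratp y + 3 * (irrp x * irrp y))
         (ratp x * irrp y + irrp x * ratp y).

Lemma z3_addA : associative z3_add.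
Proof. by move=> [a b] [c d] [e f]; congr ZSqrt3; rewrite /= addrA. Qed.

Lemma z3_addC : commutative z3_add.
Proof. by move=> [a b] [c d]; congr ZSqrt3; rewrite /= addrC. Qed.

Lemma z3_add0 : left_id z3_zero z3_add.
Proof. by move=> [a b]; congr ZSqrt3; rewrite /= add0r. Qed.

Lemma z3_addN : left_inverse z3_zero z3_opp z3_add.
Proof. by move=> [a b]; congr ZSqrt3; rewrite /= addNr. Qed.

HB.instance Definition _ :=
  GRing.isZmodule.Build zsqrt3 z3_addA z3_addC z3_add0 z3_addN.

Lemma z3_mulA : associative z3_mul.
Proof. by move=> [a b] [c d] [e f]; congr ZSqrt3 => /=; ring. Qed.

Lemma z3_mulC : commutative z3_mul.
Proof. by move=> [a b] [c d]; congr ZSqrt3 => /=; ring. Qed.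

Lemma z3_mul1 : left_id z3_one z3_mul.
Proof. by move=> [a b]; congr ZSqrt3 => /=; ring. Qed.

Lemma z3_mulD : left_distributive z3_mul z3_add.
Proof. by move=> [a b] [c d] [e f]; congr ZSqrt3 => /=; ring. Qed.

Lemma z3_one_neq0 : z3_one != z3_zero.
Proof. by []. Qed.

HB.instance Definition _ := GRing.Zmodule_isComNzRing.Build zsqrt3
  z3_mulA z3_mulC z3_mul1 z3_mulD z3_one_neq0.

Definition sqrt3 : zsqrt3 := ZSqrt3 0 1.

Definition conj3 (x : zsqrt3) : zsqrt3 := ZSqrt3 (ratp x) (- irrp x).

Definition norm3 (x : zsqrt3) : int := ratp x ^+ 2 - 3 * irrp x ^+ 2.

Lemma mul_conj3 (x : zsqrt3) : x * conj3 x = ZSqrt3 (norm3 x) 0.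
Proof. by case: x => a b; congr ZSqrt3; rewrite /norm3 /=; ring. Qed.

Lemma norm3M (x y : zsqrt3) : norm3 (x * y) = norm3 x * norm3 y.
Proof. by case: x => a b; case: y => c d; rewrite /norm3 /=; ring. Qed.

Definition z3_unit : pred zsqrt3 := fun x => norm3 x \is a GRing.unit.
Definition z3_inv (x : zsqrt3) : zsqrt3 :=
  if z3_unit x then ZSqrt3 (norm3 x) 0 * conj3 x else x.

Lemma z3_mulV : {in z3_unit, left_inverse 1 z3_inv *%R}.
Proof.
move=> x ux; have ux' : z3_unit x by [].
rewrite /z3_inv ux' -mulrA [conj3 x * x]mulrC mul_conj3.
move: ux'; rewrite /z3_unit => /divrr; set n := norm3 x => nn1.
have {}nn1 : n * n = 1 := nn1.
by congr ZSqrt3 => /=; rewrite ?nn1; ring.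
Qed.

Lemma z3_unitP (x y : zsqrt3) : y * x = 1 -> z3_unit x.
Proof.
move=> yx1; rewrite /z3_unit; apply/unitrPr; exists (norm3 y).
by rewrite mulrC -norm3M yx1.
Qed.

Lemma z3_inv_out : {in [predC z3_unit], z3_inv =1 id}.
Proof. by move=> x; rewrite inE /z3_inv => /negPf nux; rewrite ifF. Qed.

HB.instance Definition _ := GRing.ComNzRing_hasMulInverse.Build zsqrt3
  z3_mulV z3_unitP z3_inv_out.

(* The embedding of Q(sqrt 3) in the real numbers with sqrt 3 |-> sqrt 3; the
   other one is its composite with [conj3].  In [algC], 0 < z means that z is
   real and positive. *)
Definition emb3 (x : zsqrt3) : algC :=
  (ratp x)%:~R + (irrp x)%:~R * sqrtC 3.

Definition totally_positive : set zsqrt3 :=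
  [set x | 0 < emb3 x /\ 0 < emb3 (conj3 x)].

Definition sqclass_eq (x y : zsqrt3) : Prop :=
  exists2 u, u \is a GRing.unit & x = u ^+ 2 * y.

(* Subsets of Z[sqrt 3]^+ / U^2 are represented by their preimages in
   Z[sqrt 3]^+, i.e., by the sets of totally positive elements that are
   saturated for [sqclass_eq]. *)
Definition class_set (A : set zsqrt3) : Prop :=
  A `<=` totally_positive /\
  forall x y, sqclass_eq x y -> A y -> A x.

Definition classes_of (s : seq zsqrt3) : set zsqrt3 :=
  [set x | exists2 y, y \in s & sqclass_eq x y].

(* [polar Q] is 2 B_Q. *)
Definition polar (L : lmodType zsqrt3) (Q : L -> zsqrt3) (v w : L) : zsqrt3 :=
  Q (v + w) - Q v - Q w.

Record classical_lattice (L : lmodType zsqrt3) (Q : L -> zsqrt3) : Prop :=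
  ClassicalLattice {
    lattice_fin_gen : exists (n : nat) (g : 'I_n -> L),
      forall v, exists c : 'rV[zsqrt3]_n, v = \sum_i c 0 i *: g i;
    lattice_torsion_free : forall (a : zsqrt3) (v : L),
      a *: v = 0 -> a = 0 \/ v = 0;
    lattice_quadratic : forall (a : zsqrt3) (v : L),
      Q (a *: v) = a ^+ 2 * Q v;
    lattice_bilinear : forall (a : zsqrt3) (u v w : L),
      polar Q (a *: u + v) w = a * polar Q u w + polar Q v w;
    lattice_classical : forall v w : L, exists b, polar Q v w = 2 * b;
    lattice_posdef : forall v : L, v != 0 -> totally_positive (Q v)
  }.

Definition is_basis (L : lmodType zsqrt3) (n : nat) (e : 'I_n -> L) : Prop :=
  forall v, exists! c : 'rV[zsqrt3]_n, v = \sum_i c 0 i *: e i.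

Definition has_gram (L : lmodType zsqrt3) (Q : L -> zsqrt3) (n : nat)
    (G : 'M[zsqrt3]_n) : Prop :=
  exists2 e : 'I_n -> L, is_basis e &
    forall i j, polar Q (e i) (e j) = 2 * G i j.

Definition diagonal_lattice (L : lmodType zsqrt3) (Q : L -> zsqrt3) : Prop :=
  classical_lattice Q /\
  exists (n : nat) (d : 'rV[zsqrt3]_n), has_gram Q (diag_mx d).

(* The quadratic map of <G>, realized on the module of row vectors. *)
Definition gram_form (n : nat) (G : 'M[zsqrt3]_n) (v : 'rV[zsqrt3]_n) :
    zsqrt3 := (v *m G *m v^T) 0 0.

Lemma gram_form_has_gram (n : nat) (G : 'M[zsqrt3]_n) :
  G^T = G -> has_gram (gram_form G) G.
Proof.
move=> symG; exists (fun i => delta_mx 0 i) => [v|i j].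
  exists v; split; first by rewrite -row_sum_delta.
  by move=> c ->; rewrite -row_sum_delta.
pose e k : 'rV[zsqrt3]_n := delta_mx 0 k.
have entry k l : (e k *m G *m (e l)^T) 0 0 = G k l.
  by rewrite -rowE /e trmx_delta -colE !mxE.
have GC : G j i = G i j by rewrite -[in LHS]symG mxE.
have eD : ((e i + e j) *m G *m (e i + e j)^T) 0 0 =
    G i i + G i j + (G j i + G j j).
  rewrite [(e i + e j)^T]linearD /= !(mulmxDl, mulmxDr).
  by rewrite 3![(_ + _ : 'M_1) 0 0]mxE !entry; ring.
rewrite /polar /gram_form -![delta_mx 0 _]/(e _) eD !entry GC; ring.
Qed.

Definition represents (L : lmodType zsqrt3) (Q : L -> zsqrt3) (x : zsqrt3) :
    Prop := exists v, Q v = x.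

Definition universal_for (A : set zsqrt3) (L : lmodType zsqrt3)
    (Q : L -> zsqrt3) : Prop := forall x, A x -> represents Q x.

Definition lattice_family : Type :=
  forall L : lmodType zsqrt3, (L -> zsqrt3) -> Prop.

Definition criterion_set (F : lattice_family) (S A : set zsqrt3) : Prop :=
  [/\ class_set A, A `<=` S &
      forall (L : lmodType zsqrt3) (Q : L -> zsqrt3), F L Q ->
        (universal_for S Q <-> universal_for A Q)].

(* Minimality is for inclusion, among all S-criterion sets; being a least
   element, such a set is unique. *)
Definition minimal_criterion_set (F : lattice_family) (S A : set zsqrt3) :
    Prop :=
  criterion_set F S A /\ forall A', criterion_set F S A' -> A `<=` A'.

(* Definite description; [set0] is a dummy value for the case where there is
   no minimal S-criterion set. *)
Definition the_criterion_set (F : lattice_family) (S : set zsqrt3) :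
    set zsqrt3 := xget set0 (minimal_criterion_set F S).

Definition Ccl : set zsqrt3 :=
  the_criterion_set (@classical_lattice) totally_positive.

Definition Cdiag : set zsqrt3 :=
  the_criterion_set (@diagonal_lattice) totally_positive.

Definition eps : zsqrt3 := 2 + sqrt3.
Definition epsbar : zsqrt3 := conj3 eps.

Definition C_reps : seq zsqrt3 :=
  [:: 1; eps;
      4 + sqrt3; 4 - sqrt3; eps * (4 + sqrt3); eps * (4 - sqrt3);
      7 + 2 * sqrt3; 7 - 2 * sqrt3;
      eps * (7 + 2 * sqrt3); eps * (7 - 2 * sqrt3)].

Definition C : set zsqrt3 := classes_of C_reps.

(* 250000, written so that no large unary numeral has to be parsed. *)
Definition norm_bound : int := 250 * 10 ^+ 3.

Definition S_bounded : set zsqrt3 :=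
  [set x | totally_positive x /\ norm3 x <= norm_bound].

Definition diag_of (s : seq zsqrt3) : 'M[zsqrt3]_(size s) :=
  diag_mx (\row_i s`_i).

Definition ternary_form : 'rV[zsqrt3]_3 -> zsqrt3 :=
  gram_form (diag_of [:: 1; eps; 1 + eps]).

Definition gram2 (x a y : zsqrt3) : 'M[zsqrt3]_2 :=
  \matrix_(i, j) if i != j then a else if i == 0 then x else y.

Definition quaternary_form (a : zsqrt3) : 'rV[zsqrt3]_(2 + 2) -> zsqrt3 :=
  gram_form (block_mx (diag_of [:: 1; eps]) 0
                      0 (gram2 (2 + eps) a (2 + epsbar))).

Definition ternary_exceptions : seq zsqrt3 :=
  [:: 2 + epsbar; 1 + 2 * epsbar; 2 + 3 * eps; 3 + 2 * eps].

Definition quaternary_exceptions : seq zsqrt3 :=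
  [:: 5 + 2 * sqrt3; 5 - 2 * sqrt3; 8 + 2 * sqrt3; 8 - 2 * sqrt3;
      15 + 7 * sqrt3; 15 - 7 * sqrt3; 15 + 6 * sqrt3; 15 - 6 * sqrt3; 13].

Definition hypothesis_A : Prop :=
  forall x, totally_positive x ->
    (represents ternary_form x <-> ~ classes_of ternary_exceptions x).

Definition hypothesis_B : Prop :=
  forall a, a \in [:: 0; 1; 2; sqrt3; 1 + sqrt3] ->
  forall x, totally_positive x ->
    ~ classes_of quaternary_exceptions x -> represents (quaternary_form a) x.

(* Main.v *)
Require Import Defs.
From Stdlib Require Import ZArith FMapPositive MSetPositive.
From mathcomp Require Import all_boot all_order all_algebra all_field.
From mathcomp Require Import boolp classical_sets.
From mathcomp Require Import ssrZ zify ring.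

Set Implicit Arguments.
Unset Strict Implicit.
Unset Printing Implicit Defensive.

Import Order.TTheory GRing.Theory Num.Theory.
Local Open Scope ring_scope.
Local Open Scope classical_set_scope.

(** Write [s] for the square root of 3, and [e = 2 + s] for the fundamental
    unit, which has norm 1 and is totally positive but not a square.  Totally
    positive elements are compared through the norm, which is superadditive on
    them ([norm3D]), and are enumerated through their coordinates: up to squares
    of units and conjugation, each is [n + k e] with natural numbers [n] and [k]
    ([totpos_cone_form]).

    Criterion sets.  Let a lattice miss a totally positive [x] but represent
    everything of smaller norm.  Elements of norm at least that of [x], not in
    its class, can be added as diagonal entries without representing [x], and
    finitely many of them suffice to represent everything else: a large integer
    [m] times a diagonal lattice of rank 8 represents all the multiples of [m],
    by Lagrange's theorem on four squares ([sum4_nat]), and finitely many others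
    take care of the residue classes modulo [m] ([exceptional_of_minimal]).
    Hence the classes that are missed alone by some lattice form the least
    criterion set, for classical and for diagonal lattices
    ([exceptional_criterion]).  For each of the ten classes of [C] there is a
    small diagonal lattice having it as an element of minimal norm among those
    that it misses ([C_exceptional]), so that [C] is contained in both sets.

    Universality.  Conversely, let a classical lattice [L] represent [C].  As it
    represents [1] and [e], it contains [<1, e>], which is unimodular and
    splits off: [L] is the sum of [<1, e>] and some [L'].  The four classes of
    norm 13 in [C] are not represented by [<1, e>], and the ways of representing
    them leave few possibilities for [L'] ([universal_of_C]).  Either [L']
    represents one of [1], [e], [1 + e], [1 + 1/e], and then [<1, e, 1>] or
    [<1, e, 1 + e>], up to symmetries, represents everything but four classes,
    which are in [C].  Or two facts hold at the same time:
    - [L'] represents [2], or [L] contains one of the quaternary lattices;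
    - the image of this statement by the symmetry [x |-> e * conj x], which
      preserves [<1, e>].
    By elementary manipulations of sums of three squares ([rep3_2_of_eps]),
    [<1, e, 2>] represents everything but one congruence class modulo 4 up to
    squares of units, and a quaternary lattice represents everything but nine
    classes.  The exceptions left by the first fact are disjoint from those left
    by the second.

    The facts used on the forms are the universality of [<1, e, 1>], and the
    exceptions of [<1, e, 1 + e>] and of the quaternary forms.  For all norms,
    the last two are the hypotheses, and they imply the first one, since
    [<1, e, 1>] represents [x] as soon as [<1, e, 1 + e>] represents [(1 + e) x]
    ([rep3_similar]).  For norms up to 250000 they are verified by computation
    ([all_coveredT]): a table of the values of [<1, e>] is computed once, and
    each element is written as one of these values plus a small value of the
    rest of the form. *)

(** * Arithmetic of the ring of integers *)

Lemma z3_ext (x y : zsqrt3) : ratp x = ratp y -> irrp x = irrp y -> x = y.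
Proof. by case: x => a b; case: y => c d /= -> ->. Qed.

Lemma conj3K : involutive conj3.
Proof. by case=> a b; apply: z3_ext; rewrite //= opprK. Qed.

Lemma conj3D (x y : zsqrt3) : conj3 (x + y) = conj3 x + conj3 y.
Proof. by apply: z3_ext => //=; ring. Qed.

Lemma conj3M (x y : zsqrt3) : conj3 (x * y) = conj3 x * conj3 y.
Proof. by apply: z3_ext => /=; ring. Qed.

Lemma conj3X (x : zsqrt3) n : conj3 (x ^+ n) = conj3 x ^+ n.
Proof. by elim: n => [|n IHn]; rewrite ?exprS ?conj3M ?IHn. Qed.

Lemma conj3N (x : zsqrt3) : conj3 (- x) = - conj3 x.
Proof. exact: z3_ext. Qed.

Lemma norm3_conj (x : zsqrt3) : norm3 (conj3 x) = norm3 x.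
Proof. by rewrite /norm3 /=; ring. Qed.

Lemma norm3X (x : zsqrt3) n : norm3 (x ^+ n) = norm3 x ^+ n.
Proof. by elim: n => [|n IHn]; rewrite ?exprS ?norm3M ?IHn. Qed.

(** The cross term is the trace pairing with the conjugate, which is positive
    on totally positive elements: this is what makes the norm superadditive. *)
Lemma norm3D (x y : zsqrt3) :
  norm3 (x + y) = norm3 x + norm3 y + ratp (x * conj3 y) *+ 2.
Proof. by rewrite /norm3 /= mulr2n; ring. Qed.

(** The 3-adic valuation of a square is even: this is the irrationality of
    the square root of 3. *)
Lemma norm3_eq0 (x : zsqrt3) : (norm3 x == 0) = (x == 0).
Proof.
apply/eqP/eqP => [nx0|-> //].
have [irr0|irrN0] := eqVneq (irrp x) 0.
  move: nx0; rewrite /norm3 irr0 expr0n mulr0 subr0 => /eqP.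
  by rewrite sqrf_eq0 => /eqP r0; apply: z3_ext.
have eqn : (`|ratp x| ^ 2 = 3 * `|irrp x| ^ 2)%N.
  by apply/eqP; rewrite -eqz_nat PoszM -!abszX !abszE !ger0_norm ?sqr_ge0 //;
    rewrite -subr_eq0; apply/eqP.
have := congr1 (logn 3) eqn.
rewrite lognM ?expn_gt0 ?absz_gt0 ?irrN0 // !lognX => /(congr1 odd).
by rewrite oddD !oddM.
Qed.

Lemma z3_mulI (a x y : zsqrt3) : a != 0 -> a * x = a * y -> x = y.
Proof.
move=> aN0 /eqP; rewrite -subr_eq0 -mulrBr -norm3_eq0 norm3M mulf_eq0.
by rewrite !norm3_eq0 (negPf aN0) subr_eq0 => /eqP.
Qed.

Lemma z3_mul_eq0 (x y : zsqrt3) : x * y = 0 -> x = 0 \/ y = 0.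
Proof.
move=> xy0; have [->|xN0] := eqVneq x 0; first by left.
by right; apply: (z3_mulI xN0); rewrite mulr0.
Qed.

(** * Total positivity *)

Lemma emb3D : {morph emb3 : x y / x + y}.
Proof. by move=> x y; rewrite /emb3 /= !rmorphD /= mulrDl addrACA. Qed.

Lemma emb3M : {morph emb3 : x y / x * y}.
Proof.
move=> x y; rewrite /emb3 /= !(rmorphD, rmorphM) /=.
have s3 : sqrtC 3 * sqrtC 3 = 3 :> algC by rewrite -expr2 sqrtCK.
transitivity ((ratp x)%:~R * (ratp y)%:~R
  + (sqrtC 3 * sqrtC 3) * ((irrp x)%:~R * (irrp y)%:~R)
  + ((ratp x)%:~R * (irrp y)%:~R + (irrp x)%:~R * (ratp y)%:~R) * sqrtC 3
    : algC); first by rewrite s3; ring.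
by ring.
Qed.

(** The two real embeddings of [x] have sum [2 * ratp x] and product
    [norm3 x]. *)
Lemma totally_positiveE (x : zsqrt3) :
  totally_positive x <-> (0 < ratp x) && (0 < norm3 x).
Proof.
have sumE : emb3 x + emb3 (conj3 x) = (2 * ratp x)%:~R.
  by rewrite /emb3 /= rmorphM rmorphN /=; ring.
have prodE : emb3 x * emb3 (conj3 x) = (norm3 x)%:~R.
  by rewrite -emb3M mul_conj3 /emb3 /= mul0r addr0.
have real y : emb3 y \is Num.real.
  rewrite /emb3 realD ?realM ?realz //.
  by rewrite ger0_real // sqrtC_ge0 ler0n.
split=> [[px pcx]|/andP[r0 n0]].
  have : 0 < emb3 x + emb3 (conj3 x) by rewrite addr_gt0.
  have : 0 < emb3 x * emb3 (conj3 x) by rewrite mulr_gt0.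
  by rewrite sumE prodE !ltr0z => -> ?; rewrite andbT; lia.
have sum0 : 0 < emb3 x + emb3 (conj3 x) by rewrite sumE ltr0z; lia.
have prod0 : 0 < emb3 x * emb3 (conj3 x) by rewrite prodE ltr0z.
have emb0 : emb3 0 = 0 by rewrite /emb3 /= mul0r addr0.
have := real_leP (real x) (real 0); rewrite emb0 => -[nx|px]; last first.
  by refine (conj px _); rewrite -(pmulr_rgt0 _ px).
have [z|nz] := eqVneq (emb3 x) 0; first by move: prod0; rewrite z mul0r ltxx.
have {}nx : emb3 x < 0 by rewrite lt_neqAle nz nx.
have ncx : emb3 (conj3 x) < 0 by move: prod0; rewrite nmulr_rgt0.
by have := lt_trans sum0 (ltrD nx ncx); rewrite addr0 ltxx.
Qed.

(** A conditional rather than a conjunction: in the exhaustive searches below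
    the norm is then evaluated only when the trace is positive. *)
Definition totposb (x : zsqrt3) : bool :=
  if 0 < ratp x then 0 < norm3 x else false.

Lemma totposP (x : zsqrt3) : reflect (totally_positive x) (totposb x).
Proof. by apply: (iffP idP) => /totally_positiveE. Qed.

Lemma totpos_norm (x : zsqrt3) : totally_positive x -> 0 < norm3 x.
Proof. by case/totposP/andP. Qed.

Lemma totpos_neq0 (x : zsqrt3) : totally_positive x -> x != 0.
Proof. by move/totpos_norm; rewrite -norm3_eq0 => /gt_eqF ->. Qed.

Lemma totposD (x y : zsqrt3) :
  totally_positive x -> totally_positive y -> totally_positive (x + y).
Proof. by move=> [? ?] [? ?]; apply: conj; rewrite ?conj3D emb3D addr_gt0. Qed.

Lemma totposM (x y : zsqrt3) :
  totally_positive x -> totally_positive y -> totally_positive (x * y).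
Proof. by move=> [? ?] [? ?]; apply: conj; rewrite ?conj3M emb3M mulr_gt0. Qed.

Lemma totpos_conj (x : zsqrt3) :
  totally_positive x -> totally_positive (conj3 x).
Proof. by move=> [? ?]; apply: conj; rewrite ?conj3K. Qed.

Lemma totpos_sqr (x : zsqrt3) : x != 0 -> totally_positive (x ^+ 2).
Proof.
rewrite -norm3_eq0 => nN0; apply/totposP/andP; split; last first.
  by rewrite norm3X exprn_even_gt0.
move: nN0; case: x => a b; rewrite /norm3 /=; nia.
Qed.

Lemma totpos_divl (x y : zsqrt3) :
  totally_positive x -> totally_positive (x * y) -> totally_positive y.
Proof.
move=> [px pcx] [pxy pcxy]; apply: conj.
  by move: pxy; rewrite emb3M pmulr_rgt0.
by move: pcxy; rewrite conj3M emb3M pmulr_rgt0.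
Qed.

(** The closed cone of totally nonnegative elements, in which the values of a
    lattice lie.  As 0 is the only element of norm 0, it has just
    one more element than the open cone. *)
Definition psd (x : zsqrt3) : Prop := x = 0 \/ totally_positive x.

Definition psdb (x : zsqrt3) : bool := if x == 0 then true else totposb x.

Lemma psdP (x : zsqrt3) : reflect (psd x) (psdb x).
Proof.
apply: (iffP orP) => [[/eqP|/totposP]|[->|/totposP]]; [by left|by right|..].
  by left.
by right.
Qed.

Lemma psdD (x y : zsqrt3) : psd x -> psd y -> psd (x + y).
Proof.
move=> [->|px] [->|py]; rewrite ?addr0 ?add0r; [by left|by right|by right|].
by right; apply: totposD.
Qed.

Lemma psd_sqr (x : zsqrt3) : psd (x ^+ 2).
Proof.
by have [->|xN0] := eqVneq x 0; [left; rewrite expr0n|right; apply: totpos_sqr].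
Qed.

Lemma psdM (x y : zsqrt3) : psd x -> psd y -> psd (x * y).
Proof.
move=> [->|px] [->|py]; rewrite ?mulr0 ?mul0r; [by left..|].
by right; apply: totposM.
Qed.

Lemma psdDl_totpos (x y : zsqrt3) :
  totally_positive x -> psd y -> totally_positive (x + y).
Proof. by move=> px [->|py]; rewrite ?addr0 //; apply: totposD. Qed.

Lemma psd_ratp (x : zsqrt3) : psd x -> 0 <= ratp x.
Proof. by move=> [->|/totposP/andP[/ltW]]. Qed.

Lemma norm3D_lt (x y : zsqrt3) :
  totally_positive x -> totally_positive y -> norm3 x < norm3 (x + y).
Proof.
move=> px py; rewrite norm3D -addrA ltrDl.
have := totpos_norm py.
by have /totposP/andP[] := totposM px (totpos_conj py); lia.
Qed.

(** * Units and square classes *)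

(** A norm -1 is excluded modulo 4. *)
Lemma unit_norm (u : zsqrt3) : u \is a GRing.unit = (norm3 u == 1).
Proof.
have -> : (u \is a GRing.unit) = (norm3 u \is a GRing.unit) by [].
rewrite unfold_in /=; apply/orP/eqP => [[/eqP //|]|->]; last by left.
case: u => a b; rewrite /norm3 /= => /eqP n1; exfalso.
have := divz_eq a 2; have := divz_eq b 2.
have : (0 <= (a %% 2)%Z < 2) by rewrite modz_ge0 ?ltz_pmod.
have : (0 <= (b %% 2)%Z < 2) by rewrite modz_ge0 ?ltz_pmod.
move: (a %/ 2)%Z (b %/ 2)%Z (a %% 2)%Z (b %% 2)%Z => c d r s.
move=> Hs Hr Eb Ea; move: n1; rewrite Ea Eb => n1.
have [Er|Er] : r = 0 \/ r = 1 by lia.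
all: have [Es|Es] : s = 0 \/ s = 1 by lia.
all: rewrite Er Es in n1.
all: lia.
Qed.

Lemma unit_eps : eps \is a GRing.unit. Proof. by rewrite unit_norm. Qed.
Lemma unit_epsbar : epsbar \is a GRing.unit. Proof. by rewrite unit_norm. Qed.

Lemma eps_epsbar : eps * epsbar = 1. Proof. exact: z3_ext. Qed.

Lemma unit_conj (u : zsqrt3) :
  (conj3 u \is a GRing.unit) = (u \is a GRing.unit).
Proof. by rewrite !unit_norm norm3_conj. Qed.

Lemma unit_neq0 (u : zsqrt3) : u \is a GRing.unit -> u != 0.
Proof. by rewrite unit_norm -norm3_eq0 => /eqP ->. Qed.

Lemma unit_sqr_eq1 (u : zsqrt3) : norm3 u ^+ 2 = 1 -> u \is a GRing.unit.
Proof.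
move=> n1; have -> : (u \is a GRing.unit) = (norm3 u \is a GRing.unit) by [].
by apply/unitrPr; exists (norm3 u); rewrite -expr2.
Qed.

Lemma sqclass_refl (x : zsqrt3) : sqclass_eq x x.
Proof. by exists 1; rewrite ?unitr1 // expr1n mul1r. Qed.

Lemma sqclass_sym (x y : zsqrt3) : sqclass_eq x y -> sqclass_eq y x.
Proof.
move=> [u Uu ->]; exists u^-1; first by rewrite unitrV.
by rewrite mulrA -exprMn mulVr // expr1n mul1r.
Qed.

Lemma sqclass_trans (x y z : zsqrt3) :
  sqclass_eq x y -> sqclass_eq y z -> sqclass_eq x z.
Proof.
move=> [u Uu ->] [v Uv ->]; exists (u * v); first by rewrite unitrM Uu.
by rewrite exprMn mulrA.
Qed.

Lemma sqclass_conj (x y : zsqrt3) :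
  sqclass_eq x y -> sqclass_eq (conj3 x) (conj3 y).
Proof.
by move=> [u Uu ->]; exists (conj3 u); rewrite ?unit_conj // conj3M conj3X.
Qed.

Lemma sqclassMl (a x y : zsqrt3) :
  sqclass_eq x y -> sqclass_eq (a * x) (a * y).
Proof. by move=> [u Uu ->]; exists u => //; ring. Qed.

Lemma sqclass_norm (x y : zsqrt3) : sqclass_eq x y -> norm3 x = norm3 y.
Proof.
move=> [u + ->]; rewrite unit_norm => /eqP nu.
by rewrite norm3M norm3X nu expr1n mul1r.
Qed.

Lemma sqclass_totpos (x y : zsqrt3) :
  sqclass_eq x y -> totally_positive y -> totally_positive x.
Proof.
move=> [u Uu ->] py; apply: totposM => //.
exact/totpos_sqr/unit_neq0.
Qed.

(** A necessary condition for [x] and [y] to be in the same square class: the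
    irrational part of a square is even, so [x / y], i.e., [x * conj3 y]
    divided by the norm of [y], must have an even irrational part. *)
Definition sqclass_test (x y : zsqrt3) : bool :=
  (norm3 x == norm3 y) && (2 * norm3 y %| irrp (x * conj3 y))%Z.

Lemma sqclass_testP (x y : zsqrt3) : sqclass_eq x y -> sqclass_test x y.
Proof.
move=> exy; rewrite /sqclass_test (sqclass_norm exy) eqxx andTb.
have [u _ ->] := exy.
have -> : u ^+ 2 * y * conj3 y = u ^+ 2 * ZSqrt3 (norm3 y) 0.
  by rewrite -mul_conj3 mulrA.
apply/dvdzP; exists (ratp u * irrp u); case: u => a b; rewrite /norm3 /=; ring.
Qed.

Definition lincomb (n k : nat) : zsqrt3 := n%:R + k%:R * eps.

Lemma natz3 (n : nat) : n%:R = ZSqrt3 n%:Z 0 :> zsqrt3.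
Proof.
elim: n => // n IHn; rewrite -addn1 natrD IHn.
by apply: z3_ext; rewrite /= ?PoszD.
Qed.

Lemma lincombE (n k : nat) : lincomb n k = ZSqrt3 (n%:Z + 2 * k%:Z) k%:Z.
Proof. by rewrite /lincomb !natz3; apply: z3_ext => /=; ring. Qed.

Lemma norm3_lincomb (n k : nat) :
  norm3 (lincomb n k) = n%:Z ^+ 2 + 4 * (n%:Z * k%:Z) + k%:Z ^+ 2.
Proof. by rewrite lincombE /norm3 /=; ring. Qed.

Lemma eps_lincomb (n k : nat) : eps * conj3 (lincomb n k) = lincomb k n.
Proof. by rewrite !lincombE; apply: z3_ext => /=; ring. Qed.

Definition cone_form (x : zsqrt3) : Prop :=
  exists n k : nat,
    sqclass_eq x (lincomb n k) \/ sqclass_eq x (conj3 (lincomb n k)).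

Lemma cone_form_conj (x : zsqrt3) : cone_form (conj3 x) -> cone_form x.
Proof.
move=> [n [k H]]; exists n, k; rewrite -(conj3K x).
by case: H => /sqclass_conj; rewrite ?conj3K; [right|left].
Qed.

Lemma cone_form_eps (x : zsqrt3) : cone_form (eps * x) -> cone_form x.
Proof.
have step y : sqclass_eq (eps * x) y -> sqclass_eq x (eps * y).
  move=> /(sqclassMl epsbar); rewrite mulrA [epsbar * _]mulrC eps_epsbar mul1r.
  move/sqclass_trans; apply; exists epsbar; first exact: unit_epsbar.
  by rewrite -[LHS]mul1r -eps_epsbar; ring.
move=> [n [k [/step H|/step H]]]; exists k, n; last first.
  by left; rewrite -(eps_lincomb n k).
right; apply: (sqclass_trans H); rewrite -(eps_lincomb n k) conj3M conj3K.
exists eps; first exact: unit_eps.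
by rewrite -/epsbar -[LHS]mul1r -eps_epsbar; ring.
Qed.

(** The cones spanned by two consecutive powers of [eps] tile the cone of
    totally positive elements, and consecutive powers are an integral basis,
    so that every totally positive element is a combination of two of them
    with natural coefficients.  Up to squares of units, and since
    [conj3 eps = eps^-1], only the cone of [1, eps] and its conjugate remain.
    The induction moves an element with a large irrational part to the
    neighbouring cone, which decreases its trace. *)
Lemma totpos_cone_form (x : zsqrt3) : totally_positive x -> cone_form x.
Proof.
have [m] := ubnP `|ratp x|%N; elim: m x => // m IHm x.
wlog irr_ge0 : x / 0 <= irrp x => [WL ltm px|].
  have [/WL|irr_lt0] := leP 0 (irrp x); first exact.
  by apply/cone_form_conj/WL/totpos_conj; rewrite //= oppr_ge0 ltW.
move=> ltm px; have /totposP/andP[r_gt0 n_gt0] := px.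
have [lerat|ltrat] := leP (2 * irrp x) (ratp x).
  exists (absz (ratp x - 2 * irrp x)%R), (absz (irrp x)); left.
  rewrite lincombE !gez0_abs ?subr_ge0 // subrK.
  by case: (x) => a b; apply: sqclass_refl.
have pex : totally_positive (epsbar * x).
  by apply: totposM => //; apply/totposP.
apply/cone_form_conj/cone_form_eps.
have -> : eps * conj3 x = conj3 (epsbar * x) by rewrite conj3M conj3K.
apply/cone_form_conj; rewrite conj3K; apply: IHm pex.
move: ltm r_gt0 n_gt0 ltrat; case: (x) => a b; rewrite /norm3 /= => *.
suff : `|2 * a + 3 * (-1 * b)| < a by lia.
have lt3 : a < 3 * b by lia.
have lt2 : 3 * b < 2 * a by nia.
by lia.
Qed.

(** The form in which [totpos_cone_form] is used: a property of square classes
    has to be checked on two families with natural parameters. *)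
Lemma totpos_ind (P : zsqrt3 -> Prop) :
  (forall x y, sqclass_eq x y -> P y -> P x) ->
  (forall n k, P (lincomb n k)) -> (forall n k, P (conj3 (lincomb n k))) ->
  forall x, totally_positive x -> P x.
Proof. by move=> inv P1 P2 x /totpos_cone_form[n [k [|]]] /inv; apply. Qed.

(** * Ternary forms containing [<1, eps>] *)

Definition rep3 (d x : zsqrt3) : Prop :=
  exists a b c, x = a ^+ 2 + eps * b ^+ 2 + d * c ^+ 2.

Lemma rep3_sqclass (d x y : zsqrt3) :
  sqclass_eq x y -> rep3 d y -> rep3 d x.
Proof.
move=> [u _ ->] [a [b [c ->]]]; exists (u * a), (u * b), (u * c); ring.
Qed.

Lemma rep3_conj (d x : zsqrt3) : rep3 d x -> rep3 (conj3 d) (conj3 x).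
Proof.
move=> [a [b [c ->]]]; exists (conj3 a), (epsbar * conj3 b), (conj3 c).
by case: a b c d => [? ?] [? ?] [? ?] [? ?]; apply: z3_ext => /=; ring.
Qed.

Lemma rep3_eps (d x : zsqrt3) : rep3 d x -> rep3 (eps * d) (eps * x).
Proof. by move=> [a [b [c ->]]]; exists (eps * b), a, c; ring. Qed.

(** Conjugating the coefficients of a form and then scaling it by [eps] fixes
    [<1, eps>]; it is the symmetry that halves all the case distinctions. *)
Lemma rep3_dual (d x : zsqrt3) :
  rep3 d (eps * conj3 x) -> rep3 (eps * conj3 d) x.
Proof.
move=> /rep3_conj/rep3_eps; rewrite conj3M conj3K -/epsbar.
by rewrite (mulrA eps epsbar) eps_epsbar mul1r.
Qed.

(** A generator of the prime above 2. *)
Definition varpi : zsqrt3 := 1 + sqrt3.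

Definition even3 (x : zsqrt3) : bool := (2 %| ratp x + irrp x)%Z.

Lemma varpi_sqr (x : zsqrt3) : (varpi * x) ^+ 2 = 2 * eps * x ^+ 2.
Proof. by case: x => a b; apply: z3_ext => /=; ring. Qed.

Lemma even3P (x : zsqrt3) : reflect (exists y, x = varpi * y) (even3 x).
Proof.
apply: (iffP dvdzP) => [[q E]|[[a b] ->]]; last first.
  by exists (a + 2 * b) => /=; ring.
exists (ZSqrt3 (irrp x - q + irrp x) (q - irrp x)).
by apply: z3_ext => /=; lia.
Qed.

Lemma even3D (x y : zsqrt3) : even3 (x + y) = (even3 x == even3 y).
Proof. by rewrite /even3 /=; lia. Qed.

Lemma even3N (x : zsqrt3) : even3 (- x) = even3 x.
Proof. by rewrite /even3 /=; lia. Qed.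

Lemma even3M (x y : zsqrt3) : even3 (x * y) = even3 x || even3 y.
Proof.
apply/even3P/orP => [[z E]|[/even3P[z ->]|/even3P[z ->]]]; last 2 first.
- by exists (z * y); ring.
- by exists (x * z); ring.
have {z E} : even3 (x * y) by apply/even3P; exists z.
case: x y => [a b] [c d]; rewrite /even3 /= => H.
have [E1|] := boolP (2 %| a + b)%Z; first by left.
have [E2|] := boolP (2 %| c + d)%Z; first by right.
move=> o1 o2; exfalso.
have [k Ek] : exists k, a + b = 2 * k + 1.
  by exists ((a + b) %/ 2)%Z; lia.
have [l El] : exists l, c + d = 2 * l + 1.
  by exists ((c + d) %/ 2)%Z; lia.
have [m Em] := dvdzP H.
have Ea : a = 2 * k + 1 - b by lia.
have Ec : c = 2 * l + 1 - d by lia.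
by move: Em; rewrite Ea Ec => Em; lia.
Qed.

(** An odd element is congruent to [1] or to [sqrt3] modulo 2, and squaring
    turns a congruence modulo 2 into one modulo 4. *)
Lemma odd3_sqr (x : zsqrt3) :
  ~~ even3 x -> exists (e : bool) t, x ^+ 2 = (if e then 1 else 3) + 4 * t.
Proof.
rewrite /even3; case: x => a b /= o.
have [k Ek] : exists k, a + b = 2 * k + 1.
  by exists ((a + b) %/ 2)%Z; lia.
have [c [Eb|Eb]] : exists c, b = 2 * c \/ b = 2 * c + 1.
  by exists (b %/ 2)%Z; lia.
  exists true, (ZSqrt3 ((k - c) * (k - c) + (k - c) + 3 * (c * c))
                  ((2 * (k - c) + 1) * c)).
  have -> : a = 2 * (k - c) + 1 by lia.
  by rewrite Eb; apply: z3_ext => /=; ring.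
exists false, (ZSqrt3 ((k - c) * (k - c) + 3 * (c * c + c))
                (2 * ((k - c) * c) + (k - c))).
have -> : a = 2 * (k - c) by lia.
by rewrite Eb; apply: z3_ext => /=; ring.
Qed.

(** The elements that [<1, eps, 2>] misses because of a congruence modulo 4:
    they are congruent to the square of a unit plus [2 * sqrt3]. *)
Definition obstruct2 (x : zsqrt3) : bool :=
  (2 %| ratp x - 1)%Z && (4 %| irrp x - 2)%Z.

(** [b^2 + c^2 = eps (s^2 + t^2)] rotates a pair of squares of the same
    parity; an even [s] or [t] turns [eps t^2] into twice a square. *)
Lemma rep3_2_rotate (x b c s t : zsqrt3) :
  b + c = varpi * s -> b - c = varpi * t -> even3 s || even3 t ->
  rep3 2 (x ^+ 2 + b ^+ 2 + c ^+ 2).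
Proof.
move=> Es Et st.
have bcE : b ^+ 2 + c ^+ 2 = eps * s ^+ 2 + eps * t ^+ 2.
  apply: (@z3_mulI 2) => //.
  have -> : 2 * (b ^+ 2 + c ^+ 2) = (b + c) ^+ 2 + (b - c) ^+ 2 by ring.
  by rewrite Es Et !varpi_sqr; ring.
rewrite -addrA bcE.
have evenE z : even3 z -> exists w, eps * z ^+ 2 = 2 * w ^+ 2.
  by move=> /even3P[w ->]; exists (eps * w); rewrite varpi_sqr; ring.
case/orP: st => /evenE[w ->].
  by exists x, t, w; ring.
by exists x, s, w; ring.
Qed.

Lemma rep3_2_even_pair (x b c : zsqrt3) :
  even3 b == even3 c -> rep3 2 (x ^+ 2 + (varpi * b) ^+ 2 + (varpi * c) ^+ 2).
Proof.
rewrite -even3D => e.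
by apply: (@rep3_2_rotate x (varpi * b) (varpi * c) (b + c) (b - c));
  rewrite ?e //; ring.
Qed.

Lemma rep3_2_odd_pair (x b c t : zsqrt3) :
  ~~ even3 b -> ~~ even3 c -> b ^+ 2 - c ^+ 2 = 4 * t ->
  rep3 2 (x ^+ 2 + b ^+ 2 + c ^+ 2).
Proof.
move=> ob oc bc.
have /even3P[s Es] : even3 (b + c) by rewrite even3D (negPf ob) (negPf oc).
have /even3P[r Er] : even3 (b - c).
  by rewrite even3D even3N (negPf ob) (negPf oc).
apply: (rep3_2_rotate x Es Er); rewrite -even3M.
have : 2 * (eps * (s * r)) = 2 * (2 * t).
  have -> : 2 * (2 * t) = 4 * t by ring.
  rewrite -bc.
  have -> : b ^+ 2 - c ^+ 2 = (b + c) * (b - c) by ring.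
  have -> : (b + c) * (b - c) = (varpi * 1) ^+ 2 * (s * r).
    by rewrite Es Er; ring.
  by rewrite varpi_sqr; ring.
move/(@z3_mulI 2) => /(_ isT) E.
have : even3 (eps * (s * r)).
  by rewrite E /even3 /=; apply/dvdzP; exists (ratp t + irrp t); ring.
by rewrite even3M.
Qed.

(** The form [<1, eps, 2>] is a subform of [<1, eps, eps>] in which the last
    variable is even.  A representation by the latter that is not of this kind
    is a sum of three squares, in which two squares can be rotated until a
    variable becomes even, unless [x] is divisible by 2 (then the
    representation of [x / (2 * eps)] is used) or in the obstructed class. *)
Lemma rep3_2_of_eps (x : zsqrt3) :
  rep3 eps x -> (forall y, x = 2 * eps * y -> rep3 eps y) ->
  ~~ obstruct2 x -> rep3 2 x.
Proof.
move=> rx half nobs.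
have [[y xE]|not2] := pselect (exists y, x = 2 * eps * y).
  have [a [b [c yE]]] := half y xE.
  by exists (varpi * a), (varpi * b), (eps * c); rewrite xE yE !varpi_sqr; ring.
have {}not2 y : x != 2 * y.
  apply/eqP => xE; apply: not2; exists (epsbar * y); rewrite xE.
  by rewrite -[LHS]mul1r -eps_epsbar; ring.
have [a [b [c xE]]] := rx.
have [/even3P[w wE]|oddb] := boolP (even3 b).
  by exists a, c, (eps * w); rewrite xE wE varpi_sqr; ring.
have [/even3P[w wE]|oddc] := boolP (even3 c).
  by exists a, b, (eps * w); rewrite xE wE varpi_sqr; ring.
have /even3P[s Es] : even3 (b + c) by rewrite even3D (negPf oddb) (negPf oddc).
have /even3P[t Et] : even3 (b - c).
  by rewrite even3D even3N (negPf oddb) (negPf oddc).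
pose B := eps * s; pose D := eps * t.
have xE3 : x = a ^+ 2 + B ^+ 2 + D ^+ 2.
  apply: (@z3_mulI 2) => //.
  have -> : 2 * x = 2 * a ^+ 2 + eps * ((b + c) ^+ 2 + (b - c) ^+ 2).
    by rewrite xE; ring.
  by rewrite Es Et !varpi_sqr /B /D; ring.
have BD : even3 B = even3 D.
  have E : b = c + varpi * t by rewrite -Et; ring.
  suff : even3 (B + D) by rewrite even3D => /eqP.
  rewrite -mulrDr even3M; apply/orP; right.
  have : varpi * (s + t) = 2 * b by rewrite mulrDr -Es -Et; ring.
  have -> : 2 * b = varpi * ((sqrt3 - 1) * b).
    by case: (b) => ? ?; apply: z3_ext => /=; ring.
  move/(@z3_mulI varpi) => /(_ isT) ->.
  by rewrite even3M.
have [evB|oddB] := boolP (even3 B); last first.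
  have oddD : ~~ even3 D by rewrite -BD.
  have [e [B' EB]] := odd3_sqr oddB; have [f [D' ED]] := odd3_sqr oddD.
  have [/even3P[a' aE]|odda] := boolP (even3 a).
    (* three squares of which two are odd: divisible by 2 *)
    exfalso; move/eqP: (not2 (eps * a' ^+ 2 + (if e then 0 else 1)
      + (if f then 1 else 2) + 2 * B' + 2 * D')); apply.
    by rewrite xE3 aE varpi_sqr EB ED; case: (e); case: (f); ring.
  (* two of three odd squares are congruent modulo 4 *)
  have [g [a' Ea]] := odd3_sqr odda.
  have [ef|nef] := eqVneq e f.
    by rewrite xE3; apply: (@rep3_2_odd_pair _ _ _ (B' - D')) => //;
      rewrite EB ED ef; ring.
  have [eg|neg] := eqVneq e g.
    have -> : x = D ^+ 2 + a ^+ 2 + B ^+ 2 by rewrite xE3; ring.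
    by apply: (@rep3_2_odd_pair _ _ _ (a' - B')) => //; rewrite Ea EB eg; ring.
  have fg : f = g by move: nef neg; case: (e); case: (f); case: (g).
  have -> : x = B ^+ 2 + a ^+ 2 + D ^+ 2 by rewrite xE3; ring.
  by apply: (@rep3_2_odd_pair _ _ _ (a' - D')) => //; rewrite Ea ED fg; ring.
have evD : even3 D by rewrite -BD.
case/even3P: evB => B' EB; case/even3P: evD => D' ED.
have [same|diff] := boolP (even3 B' == even3 D').
  by rewrite xE3 EB ED; apply: rep3_2_even_pair.
have [/even3P[a' aE]|odda] := boolP (even3 a).
  have [sameB|diffB] := boolP (even3 a' == even3 B').
    have -> : x = D ^+ 2 + (varpi * a') ^+ 2 + (varpi * B') ^+ 2.
      by rewrite xE3 EB aE; ring.
    exact: rep3_2_even_pair.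
  have -> : x = B ^+ 2 + (varpi * a') ^+ 2 + (varpi * D') ^+ 2.
    by rewrite xE3 ED aE; ring.
  apply: rep3_2_even_pair.
  by move: diff diffB; case: (even3 a'); case: (even3 B'); case: (even3 D').
(* an odd square plus [2 * eps] times an odd square: the obstructed class *)
case/negP: nobs; have [g [a' Ea]] := odd3_sqr odda.
have obs y z : ~~ even3 y -> even3 z ->
    obstruct2 (a ^+ 2 + 2 * eps * (y ^+ 2 + z ^+ 2)).
  move=> oy /even3P[w ->]; have [e [y' Ey]] := odd3_sqr oy.
  rewrite Ea Ey varpi_sqr.
  have -> : (if g then 1 else 3) + 4 * a' +
      2 * eps * ((if e then 1 else 3) + 4 * y' + 2 * eps * w ^+ 2) =
    (if g then 1 else 3) + 2 * eps + 4 * (a' + (if e then 0 else eps)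
      + 2 * eps * y' + eps ^+ 2 * w ^+ 2).
    by case: (e); ring.
  move: (a' + _ + _ + _) => r; rewrite /obstruct2.
  by case: (g) => /=; apply/andP; split; lia.
rewrite xE3 EB ED !varpi_sqr -addrA -mulrDr.
have [oB|eB] := boolP (even3 B'); last first.
  by apply: obs => //; move: diff; rewrite (negPf eB); case: (even3 D').
by rewrite [B' ^+ 2 + _]addrC; apply: obs => //;
  move: diff; rewrite oB; case: (even3 D').
Qed.

(** [<1, eps>] represents [1 + eps], and its similarity of norm [1 + eps]
    turns [<1, eps, 1 + eps>] into [<1, eps, 1>].  As [1 + eps] is
    [sqrt3 * varpi] and [eps] is -1 modulo [1 + eps], a value of [<1, eps>]
    divisible by [1 + eps] comes from this similarity, after a change of sign
    modulo [sqrt3]. *)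
Lemma rep3_similar (x : zsqrt3) :
  rep3 (1 + eps) ((1 + eps) * x) -> rep3 1 x.
Proof.
move=> [a [b [c xE]]].
have div_s y z : y * z = (1 + eps) * (b ^+ 2 + c ^+ 2 - x) ->
    even3 y = even3 z -> (3 %| ratp y)%Z -> exists s, y = (1 + eps) * s.
  move=> yz eyz /dvdzP[q Ey].
  have y3 : y = sqrt3 * ZSqrt3 (irrp y) q.
    by apply: z3_ext => /=; rewrite ?Ey; ring.
  have : even3 (y * z) by rewrite yz even3M.
  rewrite even3M -eyz orbb y3 even3M => /even3P[s ->].
  by exists s; rewrite mulrA.
have prod : (b - a) * (b + a) = (1 + eps) * (b ^+ 2 + c ^+ 2 - x).
  by rewrite mulrBr xE; ring.
have parity : even3 (b - a) = even3 (b + a) by rewrite !even3D even3N.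
have : (3 %| ratp (b - a) * ratp (b + a))%Z.
  have := congr1 ratp prod; move: (b ^+ 2 + c ^+ 2 - x) => w /= E.
  apply/dvdzP; exists (ratp w + irrp w - (irrp b - irrp a) * (irrp b + irrp a)).
  by move: E; lia.
have pr3 : prime 3 by [].
rewrite dvdzE abszM Euclid_dvdM // -!dvdzE => H.
have fin s e : b = e - s * (1 + eps) \/ b = s * (1 + eps) - e ->
    e = a \/ e = - a -> rep3 1 x.
  move=> bE eE; have e2 : e ^+ 2 = a ^+ 2 by case: eE => ->; ring.
  exists (e - eps * s), s, c; apply: (@z3_mulI (1 + eps)) => //.
  rewrite xE -e2; have -> : b ^+ 2 = (e - s * (1 + eps)) ^+ 2.
    by case: bE => ->; ring.
  by ring.
case/orP: H => [/(div_s _ _ prod parity)|].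
  move=> [s Es]; apply: (fin (- s) a); [left|by left].
  by transitivity (b - a + a); [ring|rewrite Es; ring].
rewrite mulrC in prod; move/(div_s _ _ prod (esym parity)) => [s Es].
apply: (fin (- s) (- a)); [left|by right].
by transitivity (b + a - a); [ring|rewrite Es; ring].
Qed.

(** * Classical lattices containing [<1, eps>] *)

Lemma polarC (L : lmodType zsqrt3) (Q : L -> zsqrt3) v w :
  polar Q v w = polar Q w v.
Proof. by rewrite /polar (addrC v w); ring. Qed.

Lemma quadD (L : lmodType zsqrt3) (Q : L -> zsqrt3) v w :
  Q (v + w) = Q v + Q w + polar Q v w.
Proof. by rewrite /polar; ring. Qed.

Lemma quad0 (L : lmodType zsqrt3) (Q : L -> zsqrt3) :
  classical_lattice Q -> Q 0 = 0.
Proof.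
by move=> cl; rewrite -(scale0r 0) (lattice_quadratic cl) expr0n mul0r.
Qed.

Lemma polar0 (L : lmodType zsqrt3) (Q : L -> zsqrt3) w :
  classical_lattice Q -> polar Q 0 w = 0.
Proof. by move=> cl; rewrite /polar add0r (quad0 cl) subr0 subrr. Qed.

Lemma polarZ (L : lmodType zsqrt3) (Q : L -> zsqrt3) a v w :
  classical_lattice Q -> polar Q (a *: v) w = a * polar Q v w.
Proof.
by move=> cl; rewrite -[a *: v]addr0 (lattice_bilinear cl) polar0 // addr0.
Qed.

Lemma polarD (L : lmodType zsqrt3) (Q : L -> zsqrt3) u v w :
  classical_lattice Q -> polar Q (u + v) w = polar Q u w + polar Q v w.
Proof.
by move=> cl; rewrite -{1}[u]scale1r (lattice_bilinear cl) mul1r.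
Qed.

Lemma quad_comb (L : lmodType zsqrt3) (Q : L -> zsqrt3) s t v w :
  classical_lattice Q ->
  Q (s *: v + t *: w) = s ^+ 2 * Q v + s * t * polar Q v w + t ^+ 2 * Q w.
Proof.
move=> cl; rewrite quadD !(lattice_quadratic cl) polarZ // polarC polarZ //.
by rewrite (polarC Q w v); ring.
Qed.

Lemma quad_psd (L : lmodType zsqrt3) (Q : L -> zsqrt3) v :
  classical_lattice Q -> psd (Q v).
Proof.
move=> cl; have [->|vN0] := eqVneq v 0; first by left; apply: quad0.
by right; apply: lattice_posdef.
Qed.

(** The inequality of Cauchy and Schwarz. *)
Lemma gram_psd (L : lmodType zsqrt3) (Q : L -> zsqrt3) v w b :
  classical_lattice Q -> polar Q v w = 2 * b -> totally_positive (Q w) ->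
  psd (Q v * Q w - b ^+ 2).
Proof.
move=> cl vw pw; have := quad_psd (Q w *: v + (- b) *: w) cl.
rewrite quad_comb // vw.
have -> : Q w ^+ 2 * Q v + Q w * - b * (2 * b) + (- b) ^+ 2 * Q w =
  Q w * (Q v * Q w - b ^+ 2) by ring.
move=> [/z3_mul_eq0[E|]|]; first by move: (totpos_neq0 pw); rewrite E.
  by left.
by move/(totpos_divl pw); right.
Qed.

(** The vectors orthogonal to the sublattice [<1, eps>] spanned by [e] and
    [f]. *)
Definition perp (L : lmodType zsqrt3) (Q : L -> zsqrt3) (e f v : L) : Prop :=
  polar Q v e = 0 /\ polar Q v f = 0.

Definition rep_perp (L : lmodType zsqrt3) (Q : L -> zsqrt3) (e f : L)
  (d : zsqrt3) : Prop := exists2 v, perp Q e f v & Q v = d.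

Definition unimodular_pair (L : lmodType zsqrt3) (Q : L -> zsqrt3) (e f : L) :=
  [/\ Q e = 1, Q f = eps & polar Q e f = 0].

(** By the inequality of Cauchy and Schwarz, [eps - b ^+ 2] is totally
    nonnegative for the scalar product [b] of the two vectors; as [eps] is not a
    square, this leaves only [b = 0]. *)
Lemma unimodular_pairP (L : lmodType zsqrt3) (Q : L -> zsqrt3) :
  classical_lattice Q -> represents Q 1 -> represents Q eps ->
  exists e f, unimodular_pair Q e f.
Proof.
move=> cl [e Qe] [f Qf]; exists e, f; split=> //.
have [b ef] := lattice_classical cl e f; have fe := ef; rewrite polarC in fe.
have := gram_psd cl fe; rewrite Qe Qf mulr1 => /(_ _)/psdP.
have p1 : totally_positive 1 by apply/totposP.
move=> /(_ p1) H; rewrite ef; suff -> : b = 0 by rewrite mulr0.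
move: H; case: b {ef fe} => p q; rewrite /psdb /totposb => H.
have H0 : p * p + 3 * (q * q) <= 2.
  case/orP: H => [/eqP E|/andP[E _]].
    by have := congr1 ratp E; rewrite /=; lia.
  by move: E; rewrite /=; lia.
have q0 : q = 0 by nia.
have p1' : p = 0 \/ p = 1 \/ p = - 1 by nia.
by move: H; rewrite q0; case: p1' => [->|[->|->]].
Qed.

Lemma perp_comb (L : lmodType zsqrt3) (Q : L -> zsqrt3) e f s t v w :
  classical_lattice Q -> perp Q e f v -> perp Q e f w ->
  perp Q e f (s *: v + t *: w).
Proof.
move=> cl [ve vf] [we wf].
by split; rewrite polarD // !polarZ // ?ve ?vf ?we ?wf !mulr0 addr0.
Qed.

Lemma quad_perp (L : lmodType zsqrt3) (Q : L -> zsqrt3) e f a b v :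
  classical_lattice Q -> unimodular_pair Q e f -> perp Q e f v ->
  Q (a *: e + b *: f + v) = a ^+ 2 + eps * b ^+ 2 + Q v.
Proof.
move=> cl [Qe Qf ef] [ve vf]; rewrite quadD quad_comb // Qe Qf ef.
by rewrite polarC -[v]addr0 polarC polarD // !polarZ // !(polarC Q _ (v + 0))
  addr0 ve vf; ring.
Qed.

(** A unimodular sublattice splits off as an orthogonal summand. *)
Lemma unimodular_split (L : lmodType zsqrt3) (Q : L -> zsqrt3) e f x :
  classical_lattice Q -> unimodular_pair Q e f -> represents Q x ->
  exists a b d, x = a ^+ 2 + eps * b ^+ 2 + d /\ rep_perp Q e f d.
Proof.
move=> cl uef [v <-]; have [Qe Qf ef] := uef.
have [a va] := lattice_classical cl v e.
have [b vb] := lattice_classical cl v f.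
pose w := v - (a *: e + (epsbar * b) *: f).
have wperp : perp Q e f w.
  have ee : polar Q e e = 2.
    by rewrite /polar -[e]scale1r -scalerDl !(lattice_quadratic cl) Qe.
  have ff : polar Q f f = 2 * eps.
    by rewrite /polar -[f]scale1r -scalerDl !(lattice_quadratic cl) Qf.
  rewrite /w -scaleN1r; split; rewrite polarD // polarZ // polarD // !polarZ //.
    by rewrite va ee polarC ef; ring.
  rewrite vb ff ef; have -> : epsbar * b * (2 * eps) = (eps * epsbar) * (2 * b).
    by ring.
  by rewrite eps_epsbar; ring.
exists a, (epsbar * b), (Q w); split; last by exists w.
by rewrite -(quad_perp _ _ cl uef wperp) /w addrC subrK.
Qed.

Lemma rep_perp_psd (L : lmodType zsqrt3) (Q : L -> zsqrt3) e f d :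
  classical_lattice Q -> rep_perp Q e f d -> psd d.
Proof. by move=> cl [v _ <-]; apply: quad_psd. Qed.

Lemma rep_perp_sqclass (L : lmodType zsqrt3) (Q : L -> zsqrt3) e f c d :
  classical_lattice Q -> sqclass_eq c d -> rep_perp Q e f d -> rep_perp Q e f c.
Proof.
move=> cl [u _ ->] [v pv <-]; exists (u *: v); last exact: lattice_quadratic.
by have := perp_comb u 0 cl pv pv; rewrite scale0r addr0.
Qed.

Lemma rep_perp_rep3 (L : lmodType zsqrt3) (Q : L -> zsqrt3) e f d x :
  classical_lattice Q -> unimodular_pair Q e f ->
  rep_perp Q e f d -> rep3 d x -> represents Q x.
Proof.
move=> cl uef [v pv <-] [a [b [c ->]]]; exists (a *: e + b *: f + c *: v).
have pcv : perp Q e f (c *: v).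
  by have := perp_comb c 0 cl pv pv; rewrite scale0r addr0.
by rewrite quad_perp // (lattice_quadratic cl) [c ^+ 2 * _]mulrC.
Qed.

(** The quaternary analogue of [rep3]: [p, a, q] are the entries of the Gram
    matrix of the second summand. *)
Definition rep4 (p a q x : zsqrt3) : Prop :=
  exists b c s t, x = b ^+ 2 + eps * c ^+ 2 +
    (p * s ^+ 2 + 2 * a * (s * t) + q * t ^+ 2).

Lemma perp_rep4 (L : lmodType zsqrt3) (Q : L -> zsqrt3) e f v w a x :
  classical_lattice Q -> unimodular_pair Q e f ->
  perp Q e f v -> perp Q e f w -> polar Q v w = 2 * a ->
  rep4 (Q v) a (Q w) x -> represents Q x.
Proof.
move=> cl uef pv pw vw [b [c [s [t ->]]]].
exists (b *: e + c *: f + (s *: v + t *: w)).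
by rewrite quad_perp ?quad_comb //; [rewrite vw; ring|apply: perp_comb].
Qed.

(** * Exhaustive enumeration of small decompositions *)

Definition box (R : nat) : seq zsqrt3 :=
  [seq ZSqrt3 (i%:Z - R%:Z) (j%:Z - R%:Z) |
     i <- iota 0 (R + R).+1, j <- iota 0 (R + R).+1].

Lemma mem_box (R : nat) (x : zsqrt3) :
  ratp x ^+ 2 < R.+1%:Z ^+ 2 -> irrp x ^+ 2 < R.+1%:Z ^+ 2 -> x \in box R.
Proof.
case: x => a b /= ha hb; apply/allpairsP.
have {}ha : - R%:Z <= a <= R by nia.
have {}hb : - R%:Z <= b <= R by nia.
exists (absz (a + R%:Z)%R, absz (b + R%:Z)%R); rewrite !mem_iota /=.
split; [by lia|by lia|by congr ZSqrt3; lia].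
Qed.

(** [d * x ^+ 2] is a positive definite quadratic form in the two coordinates
    of [x], of determinant [3 * norm3 d]; hence the bound on [x] in the
    decompositions [y = d * x ^+ 2 + z]. *)
Definition all_decompositions (R : nat) (d y : zsqrt3)
    (P : zsqrt3 -> zsqrt3 -> bool) : bool :=
  (ratp d * ratp y < R.+1%:Z ^+ 2) &&
  all (fun x => let z := y - d * x ^+ 2 in if psdb z then P x z else true)
    (box R).

Lemma all_decompositionsP (R : nat) (d y : zsqrt3) P :
  all_decompositions R d y P -> totally_positive d ->
  forall x z, y = d * x ^+ 2 + z -> psd z -> P x z.
Proof.
move=> /andP[bound /allP H] /totposP/andP[d_gt0 nd_gt0] x z yE pz.
suff xbox : x \in box R.
  have := H x xbox; have -> /= : y - d * x ^+ 2 = z by rewrite yE; ring.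
  by move/psdP: pz => ->.
have {yE pz} le : ratp (d * x ^+ 2) <= ratp y.
  by rewrite yE /= lerDl; apply: psd_ratp.
case: d d_gt0 nd_gt0 bound le {H} => d e; case: x => p q.
rewrite /norm3 /= => d_gt0 nd_gt0 bound le.
set A := (d * _ + _) in le.
have dA : d * A <= d * ratp y by rewrite ler_wpM2l // ltW.
have Eq : d * A = (d * p + 3 * e * q) ^+ 2 + 3 * (d ^+ 2 - 3 * e ^+ 2) * q ^+ 2.
  by rewrite /A; ring.
have Ep : d * A =
    3 * (d * q + e * p) ^+ 2 + (d ^+ 2 - 3 * e ^+ 2) * p ^+ 2.
  by rewrite /A; ring.
move: nd_gt0 Eq Ep dA; set n := d ^+ 2 - _; set u := (_ + _) ^+ 2.
set v := (d * q + _) ^+ 2 => n_gt0 Eq Ep dA.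
have u0 : 0 <= u by apply: sqr_ge0.
have v0 : 0 <= v by apply: sqr_ge0.
have p0 : 0 <= p ^+ 2 by apply: sqr_ge0.
have q0 : 0 <= q ^+ 2 by apply: sqr_ge0.
have np : p ^+ 2 <= n * p ^+ 2 by rewrite ler_peMl.
have nq : q ^+ 2 <= n * q ^+ 2 by rewrite ler_peMl.
by apply: mem_box => /=; apply: le_lt_trans bound; lia.
Qed.

(** * Universality of the lattices representing the ten classes *)

(** What is used of the ternary and quaternary forms, for the totally positive
    elements whose norm satisfies [bd].  It holds for all norms under the
    two hypotheses of the conditional part, and for all norms up to the given
    bound unconditionally. *)
Record form_facts (bd : int -> Prop) : Prop := FormFacts {
  facts_closed : forall m n, 0 < m -> m <= n -> bd n -> bd m;
  facts_unit : forall x, totally_positive x -> bd (norm3 x) -> rep3 1 x;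
  facts_ternary : forall x, totally_positive x -> bd (norm3 x) ->
    ~ classes_of ternary_exceptions x -> rep3 (1 + eps) x;
  facts_quaternary : forall a, a \in [:: 0; 1; 2; sqrt3; 1 + sqrt3] ->
    forall x, totally_positive x -> bd (norm3 x) ->
    ~ classes_of quaternary_exceptions x -> rep4 (2 + eps) a (2 + epsbar) x
}.

(** The units by which the representatives of equal classes differ below are
    among the three that are tried. *)
Definition sub_classes_test (s t : seq zsqrt3) : bool :=
  all (fun x => has (fun y => has (fun u => x == u ^+ 2 * y)
                                [:: 1; eps; epsbar]) t) s.

Lemma sub_classes (s t : seq zsqrt3) x :
  sub_classes_test s t -> classes_of s x -> classes_of t x.
Proof.
move=> /allP H [y /H/hasP[z zt /hasP[u us /eqP yE]] xy].
exists z => //; apply: (sqclass_trans xy); exists u => //.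
by move: us; rewrite !inE => /or3P[] /eqP ->; rewrite unit_norm.
Qed.

Lemma classes_conj (s : seq zsqrt3) x :
  classes_of s (conj3 x) -> classes_of [seq conj3 y | y <- s] x.
Proof.
move=> [y ys /sqclass_conj]; rewrite conj3K => xy.
by exists (conj3 y) => //; apply: map_f.
Qed.

Lemma totpos_dual (x : zsqrt3) :
  totally_positive x -> totally_positive (eps * conj3 x).
Proof. by move=> px; apply: totposM (totpos_conj px); apply/totposP. Qed.

Lemma norm3_dual (x : zsqrt3) : norm3 (eps * conj3 x) = norm3 x.
Proof. by rewrite norm3M norm3_conj mul1r. Qed.

Lemma dualK (x : zsqrt3) : eps * conj3 (eps * conj3 x) = x.
Proof. by rewrite conj3M conj3K mulrA eps_epsbar mul1r. Qed.

Lemma rep4_sqclass (p a q x y : zsqrt3) :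
  sqclass_eq x y -> rep4 p a q y -> rep4 p a q x.
Proof.
move=> [u _ ->] [b [c [s [t ->]]]].
by exists (u * b), (u * c), (u * s), (u * t); ring.
Qed.

Lemma rep4_opp (p a q x : zsqrt3) : rep4 p (- a) q x -> rep4 p a q x.
Proof. by move=> [b [c [s [t ->]]]]; exists b, c, s, (- t); ring. Qed.

Lemma rep4_conj (p a q x : zsqrt3) :
  rep4 p a q (conj3 x) -> rep4 (conj3 q) (conj3 a) (conj3 p) x.
Proof.
move=> [b [c [s [t /(congr1 conj3)]]]]; rewrite conj3K => ->.
exists (conj3 b), (epsbar * conj3 c), (conj3 t), (conj3 s).
by case: p a q b c s t => [? ?] [? ?] [? ?] [? ?] [? ?] [? ?] [? ?];
  apply: z3_ext => /=; ring.
Qed.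

Lemma rep4_dual (p a q x : zsqrt3) :
  rep4 p a q (eps * conj3 x) ->
  rep4 (eps * conj3 p) (conj3 a) (epsbar * conj3 q) x.
Proof.
move=> [b [c [s [t /(congr1 (fun y => eps * conj3 y))]]]]; rewrite dualK => ->.
exists (conj3 c), (conj3 b), (conj3 s), (eps * conj3 t).
by case: p a q b c s t => [? ?] [? ?] [? ?] [? ?] [? ?] [? ?] [? ?];
  apply: z3_ext => /=; ring.
Qed.

Definition quaternary_offdiag (a : zsqrt3) : bool :=
  has (fun b => b \in [:: 0; 1; 2; sqrt3; 1 + sqrt3])
      [:: a; - a; conj3 a; - conj3 a].

(** Conjugation exchanges the two diagonal entries and conjugates the
    off-diagonal one, whose sign can also be changed. *)
Lemma facts_quaternary_sym bd a x : form_facts bd -> quaternary_offdiag a ->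
  totally_positive x -> bd (norm3 x) ->
  ~ classes_of quaternary_exceptions x -> rep4 (2 + eps) a (2 + epsbar) x.
Proof.
move=> ff /hasP[b bL bin] px bx nx.
have conjL c : c \in [:: 0; 1; 2; sqrt3; 1 + sqrt3] ->
    rep4 (2 + eps) (conj3 c) (2 + epsbar) x.
  move=> cL; have -> : 2 + eps = conj3 (2 + epsbar) by [].
  have {2}-> : epsbar = conj3 eps by [].
  have -> : 2 + conj3 eps = conj3 (2 + eps) by [].
  apply/rep4_conj/(facts_quaternary ff) => //; first exact: totpos_conj.
    by rewrite norm3_conj.
  by move/classes_conj => ex; apply/nx/(sub_classes _ ex).
move: bL; rewrite 3!in_cons mem_seq1 => /or4P[] /eqP bE; rewrite {}bE in bin.
- exact: (facts_quaternary ff).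
- exact/rep4_opp/(facts_quaternary ff).
- by rewrite -(conj3K a); apply: conjL.
- by apply: rep4_opp; rewrite -(conj3K (- a)) conj3N; apply: conjL.
Qed.

(** The elements possibly missed by a lattice whose orthogonal complement of
    [<1, eps>] represents [2], or both [2 + eps] and [2 + epsbar]. *)
Definition half_exception (x : zsqrt3) : Prop :=
  obstruct2 x \/ classes_of quaternary_exceptions x.

Lemma obstruct2_sqclass (x y : zsqrt3) :
  sqclass_eq x y -> obstruct2 x -> obstruct2 y.
Proof.
move=> /sqclass_sym[u + ->]; rewrite unit_norm => /eqP.
case: u x => p q [a b]; rewrite /obstruct2 /norm3 /= => n1.
have [[[p' Ep] [q' Eq]]|[[p' Ep] [q' Eq]]] :
    ((exists r, p = 2 * r + 1) /\ (exists r, q = 2 * r)) \/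
    ((exists r, p = 2 * r) /\ (exists r, q = 2 * r + 1)).
  have [l El] : exists l, p = 2 * l \/ p = 2 * l + 1.
    by exists (p %/ 2)%Z; lia.
  have [m Em] : exists m, q = 2 * m \/ q = 2 * m + 1.
    by exists (q %/ 2)%Z; lia.
  case: El Em => El [] Em; rewrite El Em in n1 *.
  - by lia.
  - by right; split; [exists l|exists m].
  - by left; split; [exists l|exists m].
  - by lia.
all: rewrite Ep Eq => /andP[/dvdzP[r Er] /dvdzP[s Es]].
all: have Ea : a = r * 2 + 1 by lia.
all: have Eb : b = s * 4 + 2 by lia.
all: by rewrite Ea Eb; apply/andP; split; lia.
Qed.

(** The elements satisfying [obstruct2] have an odd rational part and an even
    irrational part, and the symmetry [x |-> eps * conj3 x] does not preserve
    this parity.  The other combinations are excluded by computing on the nine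
    exceptions, with [obstruct2] and [sqclass_test]. *)
Lemma half_exceptions_disjoint (x : zsqrt3) :
  half_exception x -> half_exception (eps * conj3 x) -> False.
Proof.
have one y : classes_of quaternary_exceptions y ->
    obstruct2 (eps * conj3 y) -> False.
  move=> [z zs yz] /(obstruct2_sqclass (sqclassMl eps (sqclass_conj yz))).
  have /allP/(_ z zs)/negP// : all (fun z => ~~ obstruct2 (eps * conj3 z))
    quaternary_exceptions by vm_compute.
case=> [ox|ex] [oy|ey].
- by move: ox oy; case: x => a b; rewrite /obstruct2 /=; lia.
- by apply: (one _ ey); rewrite dualK.
- exact: (one _ ex).
have [z zs xz] := ex; have [t ts xt] := ey.
have /allP/(_ z zs)/allP/(_ t ts)/negP[] : all (fun z => all (fun t =>
  ~~ sqclass_test (eps * conj3 z) t) quaternary_exceptions)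
  quaternary_exceptions by vm_compute.
apply/sqclass_testP/(sqclass_trans _ xt).
exact/sqclassMl/sqclass_conj/sqclass_sym.
Qed.

(** A representation of [x] has a component in the orthogonal complement of
    [<1, eps>], whose value [d] is totally nonnegative and bounded by [x]: it is
    found in a finite list. *)
Lemma perp_of_rep (L : lmodType zsqrt3) (Q : L -> zsqrt3) e f x
    (s : seq zsqrt3) :
  classical_lattice Q -> unimodular_pair Q e f -> represents Q x ->
  all_decompositions 6 1 x
    (fun _ y => all_decompositions 6 eps y (fun _ d => d \in s)) ->
  exists2 d, d \in s & rep_perp Q e f d.
Proof.
move=> cl uef rx H.
have [a [b [d [xE rd]]]] := unimodular_split cl uef rx.
have pd := rep_perp_psd cl rd.
exists d => //; have p1 : totally_positive 1 by apply/totposP.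
have pe : totally_positive eps by apply/totposP.
have pbd : psd (eps * b ^+ 2 + d).
  by apply: psdD => //; apply: psdM; [right|apply: psd_sqr].
have {}xE : x = 1 * a ^+ 2 + (eps * b ^+ 2 + d) by rewrite xE; ring.
exact: all_decompositionsP (all_decompositionsP H p1 xE pbd) pe _ _ erefl pd.
Qed.

(** The two vectors span, with [<1, eps>], one of the quaternary lattices,
    unless their scalar product is [3] or [2 * sqrt3] up to sign: the binary
    lattice then has a short vector. *)
Lemma quaternary_half (L : lmodType zsqrt3) (Q : L -> zsqrt3) e f bd :
  classical_lattice Q -> unimodular_pair Q e f -> form_facts bd ->
  rep_perp Q e f (2 + eps) -> rep_perp Q e f (2 + epsbar) ->
  [\/ rep_perp Q e f 2, rep_perp Q e f eps |
    forall x, totally_positive x -> bd (norm3 x) ->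
      ~ classes_of quaternary_exceptions x -> represents Q x].
Proof.
move=> cl uef ff [v pv Qv] [w pw Qw]; have [a vw] := lattice_classical cl v w.
have pe : totally_positive (2 + epsbar) by apply/totposP.
have pa := gram_psd cl vw; rewrite Qv Qw in pa.
have aE : quaternary_offdiag a || has (fun d =>
    2 + eps - d * (2 * a) + d ^+ 2 * (2 + epsbar) \in [:: 2; eps])
    [:: 1; -1; varpi; - varpi].
  have all13 : all_decompositions 6 1 13 (fun a _ =>
    quaternary_offdiag a || has (fun d =>
    2 + eps - d * (2 * a) + d ^+ 2 * (2 + epsbar) \in [:: 2; eps])
    [:: 1; -1; varpi; - varpi]) by vm_compute.
  apply: (all_decompositionsP all13 _ _ (pa pe)); first by apply/totposP.
  by rewrite mul1r addrC subrK.
case/orP: aE => [aL|/hasP[d _]].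
  apply: Or33 => x px bx nx.
  apply: (perp_rep4 cl uef pv pw vw); rewrite Qv Qw.
  exact: facts_quaternary_sym ff aL px bx nx.
have : rep_perp Q e f (2 + eps - d * (2 * a) + d ^+ 2 * (2 + epsbar)).
  exists ((- 1) *: v + d *: w); first exact: perp_comb.
  by rewrite quad_comb // vw Qv Qw; ring.
by rewrite !inE => ry /orP[] /eqP yE; rewrite yE in ry;
  [apply: Or31|apply: Or32].
Qed.

(** The image of the previous lemma by the symmetry [x |-> eps * conj3 x]. *)
Lemma quaternary_dual_half (L : lmodType zsqrt3) (Q : L -> zsqrt3) e f bd :
  classical_lattice Q -> unimodular_pair Q e f -> form_facts bd ->
  rep_perp Q e f (1 + 2 * eps) -> rep_perp Q e f (1 + 2 * epsbar) ->
  [\/ rep_perp Q e f (2 * eps), rep_perp Q e f 1 |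
    forall x, totally_positive x -> bd (norm3 x) ->
      ~ classes_of quaternary_exceptions (eps * conj3 x) -> represents Q x].
Proof.
move=> cl uef ff [v pv Qv] [w pw Qw]; have [a vw] := lattice_classical cl v w.
have pe : totally_positive (1 + 2 * epsbar) by apply/totposP.
have pa := gram_psd cl vw; rewrite Qv Qw in pa.
have aE : quaternary_offdiag (conj3 a) || has (fun d =>
    1 + 2 * eps - d * (2 * a) + d ^+ 2 * (1 + 2 * epsbar) \in [:: 2 * eps; 1])
    [:: eps; - eps; varpi; - varpi].
  have all13 : all_decompositions 6 1 13 (fun a _ =>
    quaternary_offdiag (conj3 a) || has (fun d =>
    1 + 2 * eps - d * (2 * a) + d ^+ 2 * (1 + 2 * epsbar) \in [:: 2 * eps; 1])
    [:: eps; - eps; varpi; - varpi]) by vm_compute.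
  apply: (all_decompositionsP all13 _ _ (pa pe)); first by apply/totposP.
  by rewrite mul1r addrC subrK.
case/orP: aE => [aL|/hasP[d _]].
  apply: Or33 => x px bx nx.
  apply: (perp_rep4 cl uef pv pw vw); rewrite Qv Qw.
  have -> : 1 + 2 * eps = eps * conj3 (2 + eps) by apply: z3_ext.
  have -> : 1 + 2 * epsbar = epsbar * conj3 (2 + epsbar) by apply: z3_ext.
  rewrite -(conj3K a); apply: rep4_dual.
  apply: (facts_quaternary_sym ff aL) => //; first exact: totpos_dual.
  by rewrite norm3_dual.
have : rep_perp Q e f (1 + 2 * eps - d * (2 * a) + d ^+ 2 * (1 + 2 * epsbar)).
  exists ((- 1) *: v + d *: w); first exact: perp_comb.
  by rewrite quad_comb // vw Qv Qw; ring.
by rewrite !inE => ry /orP[] /eqP yE; rewrite yE in ry;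
  [apply: Or31|apply: Or32].
Qed.

(** The orthogonal complement of [<1, eps>] must contribute to the
    representation of the four classes of norm 13.  If it represents [1], [eps],
    [1 + eps] or [1 + epsbar], one of the ternary forms suffices.  Otherwise
    it represents [2], or both [2 + eps] and [2 + epsbar]; and, by duality,
    [2 * eps], or both [1 + 2 * eps] and [1 + 2 * epsbar].  Either half of
    this information gives all the elements outside a set of exceptions, and
    the two sets are disjoint. *)
Theorem universal_of_C bd (L : lmodType zsqrt3) (Q : L -> zsqrt3) :
  form_facts bd -> classical_lattice Q -> universal_for C Q ->
  forall x, totally_positive x -> bd (norm3 x) -> represents Q x.
Proof.
move=> ff cl univ.
have C_rep s x : sub_classes_test s C_reps -> classes_of s x -> represents Q x.
  by move=> t ex; apply/univ/(sub_classes t ex).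
have C1 x : sub_classes_test [:: x] C_reps -> represents Q x.
  by move/C_rep; apply; exists x; rewrite ?mem_head //; apply: sqclass_refl.
have [e [f uef]] : exists e f, unimodular_pair Q e f.
  by apply: unimodular_pairP => //; apply: C1; vm_compute.
have of_rep3 d x : rep_perp Q e f d -> rep3 d x -> represents Q x.
  exact: rep_perp_rep3.
have eps3 x : totally_positive x -> bd (norm3 x) -> rep3 eps x.
  move=> px bx; have -> : eps = eps * conj3 1 by apply: z3_ext.
  apply/rep3_dual/(facts_unit ff); first exact: totpos_dual.
  by rewrite norm3_dual.
have two3 x : totally_positive x -> bd (norm3 x) -> ~~ obstruct2 x -> rep3 2 x.
  move=> px bx; apply: rep3_2_of_eps; first exact: eps3.
  move=> y xE; have p2 : totally_positive (2 * eps) by apply/totposP.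
  have py : totally_positive y by apply: (totpos_divl p2); rewrite -xE.
  apply: eps3 => //; apply: (facts_closed ff) bx; first exact: totpos_norm.
  rewrite xE norm3M; have := totpos_norm py.
  by have -> : norm3 (2 * eps) = 4 by []; lia.
pose good := forall x, totally_positive x -> bd (norm3 x) -> represents Q x.
have good_1 : rep_perp Q e f 1 -> good.
  by move=> r x px bx; apply: (of_rep3 _ _ r); apply: (facts_unit ff).
have good_eps : rep_perp Q e f eps -> good.
  by move=> r x px bx; apply: (of_rep3 _ _ r); apply: eps3.
have good_1eps : rep_perp Q e f (1 + eps) -> good.
  move=> r x px bx; have [ex|nex] := pselect (classes_of ternary_exceptions x).
    by apply: (C_rep _ x _ ex); vm_compute.
  by apply: (of_rep3 _ _ r); apply: (facts_ternary ff).
have good_1epsbar : rep_perp Q e f (1 + epsbar) -> good.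
  move=> r x px bx.
  have [ex|nex] := pselect (classes_of ternary_exceptions (conj3 x)).
    by apply: (C_rep _ x _ (classes_conj ex)); vm_compute.
  apply: (of_rep3 _ _ r); rewrite -(conj3K x).
  have -> : 1 + epsbar = conj3 (1 + eps) by apply: z3_ext.
  apply/rep3_conj/(facts_ternary ff) => //; first exact: totpos_conj.
  by rewrite norm3_conj.
have epsbar_eps : sqclass_eq eps epsbar.
  by exists eps; [exact: unit_eps|apply: z3_ext].
have classes4 x (s : seq zsqrt3) : sub_classes_test [:: x] C_reps ->
    all_decompositions 6 1 x
      (fun _ y => all_decompositions 6 eps y (fun _ d => d \in s)) ->
    exists2 d, d \in s & rep_perp Q e f d.
  move=> xC H; exact (perp_of_rep cl uef (C1 _ xC) H).
have half1_or : good \/ (forall x, totally_positive x -> bd (norm3 x) ->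
    ~ half_exception x -> represents Q x).
  have of2 : rep_perp Q e f 2 -> forall x, totally_positive x ->
      bd (norm3 x) -> ~ half_exception x -> represents Q x.
    move=> r x px bx nx; apply: (of_rep3 _ _ r); apply: (two3 _ px bx).
    by apply/negP => ox; apply: nx; left.
  have [d ds rd] : exists2 d, d \in [:: 1; eps; 1 + eps; 2; 2 + eps] &
      rep_perp Q e f d by apply: (classes4 (2 + eps)); vm_compute.
  have [c cs rc] : exists2 d, d \in [:: 1; epsbar; 1 + epsbar; 2; 2 + epsbar] &
      rep_perp Q e f d by apply: (classes4 (2 + epsbar)); vm_compute.
  move: ds cs; rewrite !inE => ds cs.
  case/or4P: ds => [/eqP E|/eqP E|/eqP E|]; rewrite ?E in rd.
  - by left; apply: good_1.
  - by left; apply: good_eps.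
  - by left; apply: good_1eps.
  case/orP=> /eqP E; rewrite {}E in rd; first by right; apply: of2.
  case/or4P: cs => [/eqP E|/eqP E|/eqP E|]; rewrite ?E in rc.
  - by left; apply: good_1.
  - by left; apply/good_eps/(rep_perp_sqclass cl epsbar_eps).
  - by left; apply: good_1epsbar.
  case/orP=> /eqP E; rewrite {}E in rc; first by right; apply: of2.
  have [/of2|/good_eps|all4] := quaternary_half cl uef ff rd rc;
    [by right|by left|].
  by right=> x px bx nx; apply: all4 => // ex; apply: nx; right.
case: half1_or => [g|half1]; first exact: g.
have half2_or : good \/ (forall x, totally_positive x -> bd (norm3 x) ->
    ~ half_exception (eps * conj3 x) -> represents Q x).
  have of2 : rep_perp Q e f (2 * eps) -> forall x, totally_positive x ->
      bd (norm3 x) -> ~ half_exception (eps * conj3 x) -> represents Q x.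
    move=> r x px bx nx; apply: (of_rep3 _ _ r).
    have -> : 2 * eps = eps * conj3 2 by apply: z3_ext.
    apply/rep3_dual/two3; [exact: totpos_dual|by rewrite norm3_dual|].
    by apply/negP => ox; apply: nx; left.
  have [d ds rd] : exists2 d, d \in [:: 1; eps; 1 + eps; 2 * eps; 1 + 2 * eps] &
      rep_perp Q e f d by apply: (classes4 (1 + 2 * eps)); vm_compute.
  have [c cs rc] : exists2 d,
      d \in [:: 1; epsbar; 1 + epsbar; 2 * epsbar; 1 + 2 * epsbar] &
      rep_perp Q e f d by apply: (classes4 (1 + 2 * epsbar)); vm_compute.
  move: ds cs; rewrite !inE => ds cs.
  case/or4P: ds => [/eqP E|/eqP E|/eqP E|]; rewrite ?E in rd.
  - by left; apply: good_1.
  - by left; apply: good_eps.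
  - by left; apply: good_1eps.
  case/orP=> /eqP E; rewrite {}E in rd; first by right; apply: of2.
  case/or4P: cs => [/eqP E|/eqP E|/eqP E|]; rewrite ?E in rc.
  - by left; apply: good_1.
  - by left; apply/good_eps/(rep_perp_sqclass cl epsbar_eps).
  - by left; apply: good_1epsbar.
  case/orP=> /eqP E; rewrite {}E in rc.
    right; apply: of2; apply: (rep_perp_sqclass cl _ rc).
    exact: (sqclassMl 2 epsbar_eps).
  have [/of2|/good_1|all4] := quaternary_dual_half cl uef ff rd rc;
    [by right|by left|].
  by right=> x px bx nx; apply: all4 => // ex; apply: nx; right.
case: half2_or => [g|half2]; first exact: g.
move=> x px bx; have [ex|nex] := pselect (half_exception x); last exact: half1.
by apply: half2 => // /(half_exceptions_disjoint ex).
Qed.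

(** * The forms of the two hypotheses *)

Lemma gram_form_diag (n : nat) (d v : 'rV[zsqrt3]_n) :
  gram_form (diag_mx d) v = \sum_i d 0 i * v 0 i ^+ 2.
Proof.
rewrite /gram_form mul_mx_diag mxE.
by apply: eq_bigr => i _; rewrite !mxE; ring.
Qed.

Lemma gram_form_block (m n : nat) (A : 'M[zsqrt3]_m) (D : 'M[zsqrt3]_n) v :
  gram_form (block_mx A 0 0 D) v =
    gram_form A (lsubmx v) + gram_form D (rsubmx v).
Proof.
rewrite /gram_form -{1 2}[v]hsubmxK tr_row_mx mul_row_block !mulmx0 addr0 add0r.
by rewrite mul_row_col mxE.
Qed.

Lemma ternary_form_rep3 (x : zsqrt3) :
  represents ternary_form x -> rep3 (1 + eps) x.
Proof.
move=> [v <-]; exists (v 0 ord0), (v 0 (inord 1)), (v 0 (inord 2)).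
rewrite /ternary_form /diag_of gram_form_diag !big_ord_recl big_ord0 !mxE /=.
rewrite mul1r addr0 !addrA; congr (_ + _ * v 0 _ ^+ 2 + _ * v 0 _ ^+ 2);
  by apply/val_inj; rewrite /= inordK.
Qed.

Lemma quaternary_form_rep4 (a x : zsqrt3) :
  represents (quaternary_form a) x -> rep4 (2 + eps) a (2 + epsbar) x.
Proof.
move=> [v <-]; rewrite /quaternary_form gram_form_block.
move: (lsubmx v) (rsubmx v) => u w.
exists (u 0 ord0), (u 0 (inord 1)), (w 0 ord0), (w 0 (inord 1)).
have i1 : inord 1 = lift ord0 ord0 :> 'I_2 by apply/val_inj; rewrite /= inordK.
congr (_ + _).
  rewrite /diag_of gram_form_diag !big_ord_recl big_ord0 !mxE /= mul1r addr0.
  by congr (_ + _ * u 0 _ ^+ 2); apply/val_inj; rewrite /= inordK.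
rewrite /gram_form mxE !big_ord_recl big_ord0 !mxE !big_ord_recl !big_ord0 !mxE.
by rewrite i1 /=; ring.
Qed.

Lemma form_facts_of_hypotheses :
  hypothesis_A -> hypothesis_B -> form_facts (fun _ => True).
Proof.
move=> hA hB; have ternary x : totally_positive x ->
    ~ classes_of ternary_exceptions x -> rep3 (1 + eps) x.
  by move=> px nx; apply/ternary_form_rep3/hA.
split=> // [x px _|x px _ nx|a aL x px _ nx].
- apply/rep3_similar/ternary.
    by apply: totposM => //; apply/totposP.
  (* the norms of the exceptions are prime to 6 *)
  move=> [y yex /sqclass_norm]; rewrite norm3M.
  have /allP/(_ y yex) : all (fun y => ~~ (6 %| norm3 y)%Z) ternary_exceptions.
    by vm_compute.
  by move=> + E; rewrite -E; have -> : norm3 (1 + eps) = 6 by []; lia.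
- exact: ternary.
- by apply/quaternary_form_rep4/hB.
Qed.

(** * Sums of four squares *)

Definition sum4 (n : int) : Prop :=
  exists a b c d : int, n = a ^+ 2 + b ^+ 2 + c ^+ 2 + d ^+ 2.

(** Euler's identity, i.e., the multiplicativity of the norm of quaternions. *)
Lemma sum4M (m n : int) : sum4 m -> sum4 n -> sum4 (m * n).
Proof.
move=> [a [b [c [d ->]]]] [x [y [z [t ->]]]].
exists (a * x + b * y + c * z + d * t), (a * y - b * x + c * t - d * z),
  (a * z - b * t - c * x + d * y), (a * t + b * z - c * y - d * x); ring.
Qed.

Lemma centered_residue (m x : int) :
  0 < m -> exists q y, x = q * m + y /\ `|2 * y| <= m.
Proof.
move=> m0; have E := divz_eq x m; have l := ltz_pmod x m0.
have g : 0 <= (x %% m)%Z by rewrite modz_ge0 // gt_eqF.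
have [le|gt] := leP (2 * (x %% m)%Z) m.
  by exists (x %/ m)%Z, (x %% m)%Z; split=> //; rewrite ger0_norm; lia.
exists ((x %/ m)%Z + 1), ((x %% m)%Z - m); split; first by lia.
by rewrite ler0_norm; lia.
Qed.

Lemma quarters_le (m a b c d : int) :
  4 * a <= m -> 4 * b <= m -> 4 * c <= m -> 4 * d <= m -> a + b + c + d <= m.
Proof. by move=> *; lia. Qed.

Lemma quarters_eq (m a b c d : int) :
  4 * a <= m -> 4 * b <= m -> 4 * c <= m -> 4 * d <= m -> a + b + c + d = m ->
  [/\ 4 * a = m, 4 * b = m, 4 * c = m & 4 * d = m].
Proof. by move=> *; split; lia. Qed.

(** The descent of Euler and Lagrange.  Replacing the four integers by their
    centered residues modulo [m] gives a sum of four squares equal to [m * r]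
    with [r < m]; in the product of the two sums, Euler's identity produces four
    multiples of [m], so that [r * p] is again a sum of four squares. *)
Lemma sum4_descent (p m : int) : prime `|p|%N -> 0 < m < p ->
  sum4 (m * p) -> sum4 p.
Proof.
move=> pr; have [k] := ubnP `|m|%N; elim: k m => // k IHk m ltk /andP[m0 mp].
have m_div q : 1 < m -> p <> m * q.
  move=> m1 E; have : (`|m| %| `|p|)%N by rewrite E abszM dvdn_mulr.
  by case/primeP: pr => _ pr /pr/orP[] /eqP; lia.
have [->|mN1] := eqVneq m 1; first by rewrite mul1r.
have {mN1}m1 : 1 < m by lia.
move=> [x1 [x2 [x3 [x4 E]]]].
have [q1 [y1 [X1 B1]]] := centered_residue x1 m0.
have [q2 [y2 [X2 B2]]] := centered_residue x2 m0.
have [q3 [y3 [X3 B3]]] := centered_residue x3 m0.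
have [q4 [y4 [X4 B4]]] := centered_residue x4 m0.
pose S := y1 ^+ 2 + y2 ^+ 2 + y3 ^+ 2 + y4 ^+ 2.
pose D := q1 * y1 + q2 * y2 + q3 * y3 + q4 * y4.
pose T := q1 ^+ 2 + q2 ^+ 2 + q3 ^+ 2 + q4 ^+ 2.
pose r := p - m * T - 2 * D.
have Sr : S = m * r.
  have : m * p = m * (m * T + 2 * D) + S.
    by rewrite E X1 X2 X3 X4 /S /D /T; ring.
  move=> H; transitivity (m * p - m * (m * T + 2 * D)); last first.
    by rewrite /r; ring.
  by rewrite H; ring.
have bound y : `|2 * y| <= m -> 4 * y ^+ 2 <= m ^+ 2.
  move=> le; have -> : 4 * y ^+ 2 = `|2 * y| ^+ 2.
    by rewrite real_normK ?num_real //; ring.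
  by rewrite lerXn2r ?nnegrE // ltW.
have sq0 (y : int) : 0 <= y ^+ 2 by apply: sqr_ge0.
have r0 : 0 <= r by rewrite -(pmulr_rge0 _ m0) -Sr /S !addr_ge0.
have rm : r <= m by rewrite -(ler_pM2l m0) -Sr -expr2 /S quarters_le ?bound.
have pE : p = m * T + 2 * D + r by rewrite /r; ring.
have [r00|rN0] := eqVneq r 0.
  move: Sr; rewrite r00 mulr0 /S => /eqP.
  rewrite !paddr_eq0 ?addr_ge0 // !sqrf_eq0.
  move=> /andP[/andP[/andP[/eqP Y1 /eqP Y2] /eqP Y3] /eqP Y4].
  by case: (m_div T m1); rewrite pE r00 /D Y1 Y2 Y3 Y4 !mulr0 !addr0.
have [rmE|rNm] := eqVneq r m.
  (* all the residues are m/2 up to sign *)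
  have half y : 4 * y ^+ 2 = m ^+ 2 -> exists e : int, 2 * y = m * e.
    move=> e4; have : (2 * y) ^+ 2 == m ^+ 2 by rewrite -e4; apply/eqP; ring.
    by rewrite eqf_sqr => /orP[] /eqP ->; [exists 1|exists (-1)]; ring.
  move: Sr; rewrite rmE -expr2 /S => Sm.
  have [] := quarters_eq (bound _ B1) (bound _ B2) (bound _ B3) (bound _ B4) Sm.
  move=> /half[e1 E1] /half[e2 E2] /half[e3 E3] /half[e4 E4].
  case: (m_div (T + (q1 * e1 + q2 * e2 + q3 * e3 + q4 * e4) + 1) m1).
  rewrite pE rmE.
  have -> : 2 * D =
      q1 * (2 * y1) + q2 * (2 * y2) + q3 * (2 * y3) + q4 * (2 * y4).
    by rewrite /D; ring.
  by rewrite E1 E2 E3 E4; ring.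
have r_gt0 : 0 < r by rewrite lt_neqAle eq_sym rN0.
have r_lt : r < m by rewrite lt_neqAle rNm.
apply: (IHk r).
- by move: ltk r_gt0 r_lt; clear; lia.
- by rewrite r_gt0 (lt_trans r_lt).
exists (D + r), (q1 * y2 - q2 * y1 + q3 * y4 - q4 * y3),
  (q1 * y3 - q2 * y4 - q3 * y1 + q4 * y2),
  (q1 * y4 + q2 * y3 - q3 * y2 - q4 * y1).
apply: (@mulfI _ (m ^+ 2)); first by rewrite expf_neq0 // gt_eqF.
transitivity ((m * p) * S); first by rewrite Sr; ring.
have -> : m ^+ 2 * ((D + r) ^+ 2 +
  (q1 * y2 - q2 * y1 + q3 * y4 - q4 * y3) ^+ 2 +
  (q1 * y3 - q2 * y4 - q3 * y1 + q4 * y2) ^+ 2 +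
  (q1 * y4 + q2 * y3 - q3 * y2 - q4 * y1) ^+ 2) =
  (m * D + m * r) ^+ 2 + m ^+ 2 * (
  (q1 * y2 - q2 * y1 + q3 * y4 - q4 * y3) ^+ 2 +
  (q1 * y3 - q2 * y4 - q3 * y1 + q4 * y2) ^+ 2 +
  (q1 * y4 + q2 * y3 - q3 * y2 - q4 * y1) ^+ 2) by ring.
by rewrite -Sr E X1 X2 X3 X4 /S /D; ring.
Qed.

(** Among the [p + 1] residues [i^2] and [-1 - j^2], for [i] and [j] at most
    [p / 2], two coincide, and neither family has repetitions. *)
Lemma prime_dvd_sum_squares (p : nat) : prime p -> odd p ->
  exists i j, [/\ (i <= p./2)%N, (j <= p./2)%N & (p %| i ^ 2 + j ^ 2 + 1)%N].
Proof.
move=> pr oddp; have p0 := prime_gt0 pr.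
have pE : p = (p./2 + p./2).+1 by have := odd_double_half p; lia.
pose f (x : 'I_(p./2).+1 + 'I_(p./2).+1) : nat :=
  (match x with inl i => i ^ 2 %% p | inr j => p.-1 - j ^ 2 %% p end)%N.
have fp x : (f x < p)%N.
  case: x => i /=; first by rewrite ltn_mod.
  by rewrite -[X in (_ < X)%N](prednK p0) ltnS leq_subr.
have /injectivePn[x [y xy fxy]] : ~~ injectiveb (fun x => Ordinal (fp x)).
  apply/injectiveP => /leq_card; rewrite card_sum !card_ord; lia.
have {}fxy : f x = f y by case: fxy.
have sq_inj (i j : 'I_(p./2).+1) : (i ^ 2 = j ^ 2 %[mod p])%N -> i = j.
  wlog le : i j / (i <= j)%N.
    move=> WL; have [/WL//|/ltnW/WL H e] := leqP i j; exact/esym/H.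
  move/esym/eqP; rewrite eqn_mod_dvd ?leq_exp2r // subn_sqr Euclid_dvdM //.
  have li := ltn_ord i; have lj := ltn_ord j.
  case/orP=> /dvdnP[[|k] E]; apply/val_inj => /=; nia.
have cross (i j : 'I_(p./2).+1) : (i ^ 2 %% p = p.-1 - j ^ 2 %% p)%N ->
    exists i j, [/\ (i <= p./2)%N, (j <= p./2)%N & (p %| i ^ 2 + j ^ 2 + 1)%N].
  move=> e; exists i, j; split; [by rewrite -ltnS|by rewrite -ltnS|].
  have lt : (j ^ 2 %% p < p)%N by rewrite ltn_mod.
  rewrite (divn_eq (i ^ 2) p) (divn_eq (j ^ 2) p) e.
  move: (i ^ 2 %/ p)%N (j ^ 2 %/ p)%N (j ^ 2 %% p)%N lt => a b r lt.
  have -> : (a * p + (p.-1 - r) + (b * p + r) + 1 = (a + b + 1) * p)%N by nia.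
  exact: dvdn_mull.
move: x y xy fxy => [i|i] [j|j] //= ne e.
- by case/eqP: ne; congr inl; apply: sq_inj.
- exact: cross e.
- exact: cross (esym e).
- case/eqP: ne; congr inr; apply: sq_inj.
  have lti : (i ^ 2 %% p < p)%N by rewrite ltn_mod.
  have ltj : (j ^ 2 %% p < p)%N by rewrite ltn_mod.
  move: e lti ltj; move: (i ^ 2 %% p)%N (j ^ 2 %% p)%N => a b.
  by clear -p0; lia.
Qed.

Lemma sum4_prime (p : nat) : prime p -> sum4 p.
Proof.
move=> pr; have [->|] := eqVneq p 2%N; first by exists 1, 1, 0, 0.
move=> pN2; have oddp : odd p by case/even_prime: pr pN2 => // ->.
have [i [j [li lj /dvdnP[m E]]]] := prime_dvd_sum_squares pr oddp.
have pE : p = (p./2 + p./2).+1 by have := odd_double_half p; lia.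
have m0 : (0 < m)%N by case: (m) E => //; rewrite mul0n addn1.
have mp : (m < p)%N.
  rewrite -(ltn_pmul2r (prime_gt0 pr)) -E.
  move: li lj pE (prime_gt1 pr); move: (p./2) => h li lj -> h0.
  have := leq_mul li li; have := leq_mul lj lj; rewrite !mulnn.
  by move: (i ^ 2)%N (j ^ 2)%N => a b; rewrite -mulnn; nia.
apply: (@sum4_descent _ m%:Z) => //; first by rewrite !ltz_nat m0.
by exists i%:Z, j%:Z, 1, 0; rewrite -PoszM -E; lia.
Qed.

(** Lagrange's four-square theorem. *)
Theorem sum4_nat (n : nat) : sum4 n.
Proof.
have [k] := ubnP n; elim: k n => // k IHk n ltn.
have [le1|gt1] := leqP n 1.
  by exists n%:Z, 0, 0, 0; case: n le1 {ltn} => [|[|]].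
have pr := pdiv_prime gt1; have /dvdnP[q E] := pdiv_dvd n.
rewrite E PoszM; apply: sum4M; last exact: sum4_prime.
by apply: IHk; have := prime_gt1 pr; nia.
Qed.

(** * Diagonal extensions of lattices *)

Fixpoint rep_diag (s : seq zsqrt3) (x : zsqrt3) : Prop :=
  if s is d :: s' then exists a y, x = d * a ^+ 2 + y /\ rep_diag s' y
  else x = 0.

Lemma rep_diag0 (s : seq zsqrt3) : rep_diag s 0.
Proof.
by elim: s => //= d s IHs; exists 0, 0; rewrite expr0n mulr0 addr0.
Qed.

Lemma rep_diag_mem (s : seq zsqrt3) d : d \in s -> rep_diag s d.
Proof.
elim: s => //= c s IHs; rewrite inE => /orP[/eqP ->|/IHs ds].
  by exists 1, 0; rewrite expr1n mulr1 addr0; split=> //; apply: rep_diag0.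
by exists 0, d; rewrite expr0n mulr0 add0r.
Qed.

Lemma rep_diag_cat (s t : seq zsqrt3) x y :
  rep_diag s x -> rep_diag t y -> rep_diag (s ++ t) (x + y).
Proof.
elim: s x => [|d s IHs] x /=; first by move=> ->; rewrite add0r.
move=> [a [z [-> rz]]] ry; exists a, (z + y).
by rewrite addrA; split=> //; apply: IHs.
Qed.

Lemma rep_diag_psd (s : seq zsqrt3) x :
  (forall d, d \in s -> totally_positive d) -> rep_diag s x -> psd x.
Proof.
elim: s x => [|d s IHs] x ps /=; first by left.
move=> [a [y [-> ry]]]; apply: psdD.
  by apply: psdM (psd_sqr _); right; apply: ps; rewrite mem_head.
by apply: IHs ry => c cs; apply: ps; rewrite inE cs orbT.
Qed.

Definition ext_form (L : lmodType zsqrt3) (Q : L -> zsqrt3) (d : zsqrt3)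
    (v : (L * zsqrt3^o)%type) : zsqrt3 := Q v.1 + d * (v.2 : zsqrt3) ^+ 2.

Lemma polar_ext (L : lmodType zsqrt3) (Q : L -> zsqrt3) d v w :
  polar (ext_form Q d) v w = polar Q v.1 w.1 + 2 * (d * (v.2 * w.2)).
Proof.
rewrite /polar /ext_form /=; case: v w => [v x] [w y] /=.
by move: (Q _) (Q _) (Q _) => q r s; ring.
Qed.

Definition ext_gen (L : lmodType zsqrt3) (n : nat) (g : 'I_n -> L)
    (i : 'I_n.+1) : (L * zsqrt3^o)%type :=
  if unlift ord0 i is Some j then (g j, 0) else (0, 1).

Lemma ext_gen_comb (L : lmodType zsqrt3) (n : nat) (g : 'I_n -> L)
    (c : 'rV[zsqrt3]_n.+1) :
  \sum_i c 0 i *: ext_gen g i =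
    (\sum_i c 0 (lift ord0 i) *: g i, c 0 ord0 : zsqrt3^o).
Proof.
rewrite big_ord_recl /ext_gen unlift_none.
under eq_bigr do rewrite liftK.
have -> : \sum_(i < n) c 0 (lift ord0 i) *: ((g i, 0) : (L * zsqrt3^o)%type) =
    (\sum_i c 0 (lift ord0 i) *: g i, 0).
  apply: (big_ind2 (fun (x : (L * zsqrt3^o)%type) y => x = (y, 0))) => //.
    move=> x1 x2 y1 y2 -> ->.
    exact: (congr1 (fun z : zsqrt3^o => (x2 + y2, z)) (addr0 0)).
  move=> i _; set a := c _ _.
  exact: (congr1 (fun z : zsqrt3^o => (a *: g i, z)) (mulr0 a)).
move: (c 0 ord0) (\sum_i _) => a v.
transitivity ((a *: 0 + v, (a * 1 + 0 : zsqrt3)) : (L * zsqrt3^o)%type) => //.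
by rewrite scaler0 add0r mulr1 addr0.
Qed.

Definition cons_row (n : nat) (x : zsqrt3) (c : 'rV[zsqrt3]_n) :
    'rV[zsqrt3]_n.+1 :=
  \row_i if unlift ord0 i is Some j then c 0 j else x.

Lemma cons_row0 n x (c : 'rV[zsqrt3]_n) : cons_row x c 0 ord0 = x.
Proof. by rewrite mxE unlift_none. Qed.

Lemma cons_rowS n x (c : 'rV[zsqrt3]_n) i :
  cons_row x c 0 (lift ord0 i) = c 0 i.
Proof. by rewrite mxE liftK. Qed.

Lemma classical_ext (L : lmodType zsqrt3) (Q : L -> zsqrt3) d :
  classical_lattice Q -> totally_positive d -> classical_lattice (ext_form Q d).
Proof.
move=> cl pd; split.
- have [n [g gen]] := lattice_fin_gen cl; exists n.+1, (ext_gen g) => -[v x].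
  have [c ->] := gen v; exists (cons_row x c); rewrite ext_gen_comb cons_row0.
  by congr pair; apply: eq_bigr => i _; rewrite cons_rowS.
- move=> a [v x] avx; have av : a *: v = 0 := congr1 fst avx.
  have ax : a * (x : zsqrt3) = 0 := congr1 snd avx.
  have [->|aN0] := eqVneq a 0; [by left|right].
  have [a0|->] := lattice_torsion_free cl av; first by rewrite a0 eqxx in aN0.
  have [a0|x0] := z3_mul_eq0 ax.
    by rewrite a0 eqxx in aN0.
  by rewrite x0.
- move=> a [v x]; rewrite /ext_form /= (lattice_quadratic cl).
  by rewrite -[a *: x]/(a * (x : zsqrt3)); move: (Q v) => q; ring.
- move=> a [u x] [v y] [w z]; rewrite !polar_ext /= (lattice_bilinear cl).
  rewrite -[a *: x]/(a * (x : zsqrt3)).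
  by move: (polar Q u w) (polar Q v w) => r s; ring.
- move=> [v x] [w y]; have [b vw] := lattice_classical cl v w.
  by exists (b + d * (x * y)); rewrite polar_ext /= vw; ring.
- move=> [v x] vx; have [v0|vN0] := eqVneq v 0; last first.
    apply: psdDl_totpos; first exact: lattice_posdef.
    by apply: psdM (psd_sqr _); right.
  rewrite /ext_form /= v0 (quad0 cl) add0r; apply/(totposM pd)/totpos_sqr.
  by apply: contraNneq vx => x0; rewrite v0 x0.
Qed.

Lemma diagonal_ext (L : lmodType zsqrt3) (Q : L -> zsqrt3) d :
  diagonal_lattice Q -> totally_positive d -> diagonal_lattice (ext_form Q d).
Proof.
move=> [cl [n [c [e basis gram]]]] pd; split; first exact: classical_ext.
exists n.+1, (cons_row d c), (ext_gen e).
  move=> [v x]; have [b [vE uniq_b]] := basis v; exists (cons_row x b); split.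
    rewrite ext_gen_comb cons_row0 vE.
    by congr pair; apply: eq_bigr => i _; rewrite cons_rowS.
  move=> b'; rewrite ext_gen_comb => -[vE' ->].
  have bE : b = \row_i b' 0 (lift ord0 i).
    by apply: uniq_b; rewrite vE'; apply: eq_bigr => i _; rewrite mxE.
  apply/rowP => i; case: (unliftP ord0 i) => [j|] ->.
    by rewrite cons_rowS bE mxE.
  by rewrite cons_row0.
move=> i j; rewrite polar_ext /ext_gen !mxE.
case: (unliftP ord0 i) => [i'|] ->; case: (unliftP ord0 j) => [j'|] ->;
  rewrite ?liftK ?unlift_none.
- by rewrite /= gram !mxE (inj_eq lift_inj) mulr0 mulr0 addr0.
- by rewrite /= polarC polar0 // mul0r mulr0n !mulr0 addr0.
- by rewrite /= polar0 // mulr0n !mulr0 addr0.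
- by rewrite /= polar0 // mulr1n add0r !mulr1.
Qed.

Lemma zero_lattice : diagonal_lattice (fun _ : 'rV[zsqrt3]_0 => 0 : zsqrt3).
Proof.
have v0 (v w : 'rV[zsqrt3]_0) : v = w by rewrite [v]thinmx0 [w]thinmx0.
split; last first.
  exists 0%N, 0, (fun=> 0) => [v|[]//].
  by exists 0; split; [apply: v0|move=> c _; apply: v0].
split=> //.
- by exists 0%N, (fun=> 0) => v; exists 0; apply: v0.
- by move=> a v _; right; apply: v0.
- by move=> a v; rewrite mulr0.
- by move=> a u v w; rewrite /polar; ring.
- by move=> v w; exists 0; rewrite /polar; ring.
- by move=> v; rewrite (v0 v 0) eqxx.
Qed.

Definition diag_closed (F : lattice_family) : Prop :=
  forall (L : lmodType zsqrt3) (Q : L -> zsqrt3) d,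
    F L Q -> totally_positive d -> F _ (ext_form Q d).

Lemma diag_extension (F : lattice_family) (s : seq zsqrt3)
    (L : lmodType zsqrt3) (Q : L -> zsqrt3) :
  diag_closed F -> F L Q -> (forall d, d \in s -> totally_positive d) ->
  exists (L' : lmodType zsqrt3) (Q' : L' -> zsqrt3), F L' Q' /\
    forall x, represents Q' x <-> exists v y, x = Q v + y /\ rep_diag s y.
Proof.
move=> Fext; elim: s L Q => [|d s IHs] L Q FQ ps.
  exists L, Q; split=> // x; split=> [[v <-]|[v [y [-> ->]]]].
    by exists v, 0; rewrite addr0.
  by exists v; rewrite addr0.
have pd : totally_positive d by apply: ps; rewrite mem_head.
have [|L' [Q' [FQ' rep]]] := IHs _ _ (Fext _ _ _ FQ pd).
  by move=> c cs; apply: ps; rewrite inE cs orbT.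
exists L', Q'; split=> // x; rewrite rep; split.
  move=> [[v a] [y [-> ry]]]; exists v, (d * (a : zsqrt3) ^+ 2 + y).
  by rewrite addrA; split=> //; exists a, y.
move=> [v [_ [-> [a [y [-> ry]]]]]].
by exists (v, a : zsqrt3^o), y; rewrite addrA.
Qed.

(** * Criterion sets *)

Definition exceptional (F : lattice_family) (x : zsqrt3) : Prop :=
  totally_positive x /\ exists (L : lmodType zsqrt3) (Q : L -> zsqrt3),
    F L Q /\ forall y, totally_positive y ->
      (represents Q y <-> ~ sqclass_eq y x).

Lemma represents_sqclass (L : lmodType zsqrt3) (Q : L -> zsqrt3) x y :
  classical_lattice Q -> sqclass_eq x y -> represents Q y -> represents Q x.
Proof.
by move=> cl [u _ ->] [v <-]; exists (u *: v); apply: lattice_quadratic.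
Qed.

(** Elements that can be added as diagonal entries without ever contributing
    to a representation of [x]: by superadditivity of the norm, a totally
    positive element bounded by [x] has a smaller norm, unless it is [x]. *)
Definition harmless (x d : zsqrt3) : Prop :=
  [/\ totally_positive d, norm3 x <= norm3 d & ~ sqclass_eq x d].

Lemma harmless_diag (x q y : zsqrt3) s : (forall d, d \in s -> harmless x d) ->
  psd q -> rep_diag s y -> x = q + y -> y = 0.
Proof.
elim: s q y => //= d s IHs q y Hs pq [a [z [-> rz]]] xE.
have [pd nd ncl] := Hs d (mem_head _ _).
have {}Hs c : c \in s -> harmless x c.
  by move=> cs; apply: Hs; rewrite inE cs orbT.
have [a0|aN0] := eqVneq a 0.
  rewrite a0 expr0n mulr0 add0r; apply: (IHs q) => //.
  by rewrite xE a0 expr0n mulr0 add0r.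
have pz : psd z by apply: (rep_diag_psd _ rz) => c /Hs[].
have pda : totally_positive (d * a ^+ 2) by apply/totposM/totpos_sqr.
have le_da : norm3 d <= norm3 (d * a ^+ 2).
  rewrite norm3M norm3X; apply: ler_peMr; first exact/ltW/totpos_norm.
  have : 0 < norm3 a ^+ 2 by rewrite exprn_even_gt0 //= norm3_eq0.
  by move: (norm3 a ^+ 2) => n; clear; lia.
have xE' : x = d * a ^+ 2 + (q + z) by rewrite xE; ring.
case: (psdD pq pz) => [qz0|pqz]; last first.
  have := norm3D_lt pda pqz; rewrite -xE' => lt.
  by have := le_lt_trans (le_trans nd le_da) lt; rewrite ltxx.
case: ncl; exists a; last by rewrite xE' qz0 addr0 mulrC.
apply: unit_sqr_eq1; apply: (@mulfI _ (norm3 d)).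
  by rewrite gt_eqF // totpos_norm.
rewrite mulr1 -norm3X -norm3M; apply/eqP; rewrite eq_le le_da andbT.
by move: nd; rewrite xE' qz0 addr0.
Qed.

Definition four (d : zsqrt3) : seq zsqrt3 := nseq 4 d.

Lemma rep_four (d w : zsqrt3) (n : nat) :
  rep_diag (four d) (w ^+ 2 * (d * n%:R)).
Proof.
have [a [b [c [e E]]]] := sum4_nat n.
exists (w * ZSqrt3 a 0), (d * (w ^+ 2 * ZSqrt3 (b ^+ 2 + c ^+ 2 + e ^+ 2) 0)).
split.
  by rewrite natz3 E; case: d w => [? ?] [? ?]; apply: z3_ext => /=; ring.
exists (w * ZSqrt3 b 0), (d * (w ^+ 2 * ZSqrt3 (c ^+ 2 + e ^+ 2) 0)).
split; first by case: d w => [? ?] [? ?]; apply: z3_ext => /=; ring.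
exists (w * ZSqrt3 c 0), (d * (w ^+ 2 * ZSqrt3 (e ^+ 2) 0)).
split; first by case: d w => [? ?] [? ?]; apply: z3_ext => /=; ring.
exists (w * ZSqrt3 e 0), 0; split=> //.
by case: d w => [? ?] [? ?]; apply: z3_ext => /=; ring.
Qed.

(** The residue is taken in a range of length [m + m] so that it is at least
    [m], hence large, when it differs from [n]. *)
Lemma truncated_residue (m n : nat) : (0 < m)%N ->
  exists r q, [/\ n = r + m * q, r < m + m & q = 0 \/ m <= r]%N.
Proof.
move=> m0; have [lt|ge] := ltnP n (m + m).
  by exists n, 0%N; rewrite muln0 addn0; split=> //; left.
exists (m + n %% m)%N, (n %/ m).-1; split; last by right; rewrite leq_addr.
  have : (0 < n %/ m)%N by rewrite divn_gt0 //; lia.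
  by have := divn_eq n m; move: (n %/ m)%N (n %% m)%N => [|q] r //= E _; nia.
by rewrite ltn_add2l ltn_mod.
Qed.

Lemma totpos_lincomb (n k : nat) :
  0 < norm3 (lincomb n k) -> totally_positive (lincomb n k).
Proof.
move=> n0; apply/totposP; rewrite /totposb n0; case: ifP => // /negP[].
move: n0; rewrite norm3_lincomb lincombE /=.
by case: n k => [|n] [|k]; rewrite ?mulr0 ?addr0 ?expr0n //; lia.
Qed.

(** A lattice missing [x] but nothing of smaller norm can be enlarged until it
    misses only the class of [x].  Added to it are a multiple by [m] of a
    diagonal lattice of rank 8 that represents everything, [m] being a large
    integer, and, for each residue class modulo [m], harmless elements that
    are the beginning of all the progressions of difference [m] that are to be
    represented. *)
Lemma exceptional_of_minimal (F : lattice_family) (L : lmodType zsqrt3)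
    (Q : L -> zsqrt3) x :
  diag_closed F ->
  (forall (L : lmodType zsqrt3) (Q : L -> zsqrt3),
     F L Q -> classical_lattice Q) ->
  F L Q -> totally_positive x -> ~ represents Q x ->
  (forall y, totally_positive y -> norm3 y < norm3 x -> represents Q y) ->
  exceptional F x.
Proof.
move=> Fext Fcl FQ px nrx below; split=> //.
have nx0 := totpos_norm px.
have [m [m0 m_gt]] : exists m, (0 < m)%N /\ norm3 x < m%:Z ^+ 2.
  by exists (`|norm3 x|%N).+1; split=> //; nia.
have large d : totally_positive d -> m%:Z ^+ 2 <= norm3 d -> harmless x d.
  move=> pd le; have lt := lt_le_trans m_gt le; split=> //; first exact: ltW.
  by move/sqclass_norm => E; rewrite E ltxx in lt.
pose cands := [seq lincomb n k | n <- iota 0 (m + m), k <- iota 0 (m + m)].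
pose small := [seq d <- cands ++ [seq conj3 d | d <- cands]
                 | `[< harmless x d >]].
pose s := small ++ (four m%:R ++ four (m%:R * eps)).
have harm d : d \in s -> harmless x d.
  rewrite !mem_cat mem_filter => /orP[/andP[/asboolP //]|].
  have nm : norm3 m%:R = m%:Z ^+ 2 by rewrite natz3 /norm3 /=; ring.
  have pm : totally_positive m%:R.
    by apply/totposP; rewrite /totposb nm natz3 /= ltz_nat m0 exprn_gt0.
  have pe : totally_positive eps by apply/totposP.
  case/orP => /nseqP[-> _]; apply: large => //; rewrite ?nm //.
    exact: totposM.
  by rewrite norm3M nm mulr1.
have [L' [Q' [FQ' rep]]] := diag_extension Fext FQ (fun d ds =>
  let: And3 pd _ _ := harm d ds in pd).
have cl := Fcl _ _ FQ; have cl' := Fcl _ _ FQ'.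
exists L', Q'; split=> // y py; split.
  move=> ry yx; have /rep[v [z [xE rz]]] : represents Q' x.
    exact: represents_sqclass (sqclass_sym yx) ry.
  have z0 := harmless_diag harm (quad_psd v cl) rz xE.
  by apply: nrx; exists v; rewrite xE z0 addr0.
have [lt _|ge] := ltP (norm3 y) (norm3 x).
  have [v Qv] := below y py lt; apply/rep; exists v, 0.
  by rewrite Qv addr0; split=> //; apply: rep_diag0.
have of_diag z : rep_diag s z -> represents Q' z.
  by move=> rz; apply/rep; exists 0, z; rewrite quad0 // add0r.
(* an element and its reduction modulo [m] *)
have reduce n k : norm3 x <= norm3 (lincomb n k) ->
    exists r t n' k', [/\ (r < m + m)%N, (t < m + m)%N,
      lincomb n k = lincomb r t + m%:R * lincomb n' k' &
      ((r, t) = (n, k)) \/ m%:Z ^+ 2 <= norm3 (lincomb r t)].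
  move=> le; have [r [n' [En lr Hr]]] := truncated_residue n m0.
  have [t [k' [Ek lt Ht]]] := truncated_residue k m0.
  exists r, t, n', k'; split=> //.
    by rewrite /lincomb En Ek !natrD !natrM; ring.
  rewrite norm3_lincomb; case: Hr => [n0|mr]; last by right; nia.
  case: Ht => [k0|mt]; last by right; nia.
  by left; rewrite En Ek n0 k0 muln0 !addn0.
have diag_mU w n k : rep_diag (four m%:R ++ four (m%:R * eps))
    (m%:R * n%:R + w ^+ 2 * (m%:R * eps * k%:R)).
  apply: rep_diag_cat; last exact: rep_four.
  by have := rep_four m%:R 1 n; rewrite expr1n mul1r.
move: y py ge; apply: totpos_ind => [y z yz H ge nyx|n k ge nyx|n k ge nyx].
- apply: (represents_sqclass cl' yz); apply: H.
    by rewrite -(sqclass_norm yz).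
  by move=> zx; apply: nyx; apply: sqclass_trans zx.
- have [r [t [n' [k' [lr lt E Hrt]]]]] := reduce n k ge.
  apply/of_diag; rewrite E; apply: rep_diag_cat.
    apply: rep_diag_mem; rewrite mem_filter; apply/andP; split.
      apply/asboolP; case: Hrt => [[-> ->]|]; last first.
        move=> le; apply: large => //; apply: totpos_lincomb.
        by apply: lt_le_trans le; apply: le_lt_trans m_gt; apply: ltW.
      split=> //; first by apply/totpos_lincomb/(lt_le_trans nx0).
      by move/sqclass_sym.
    by rewrite mem_cat; apply/orP; left; apply/allpairsP; exists (r, t);
      rewrite !mem_iota.
  have := diag_mU 1 n' k'; rewrite expr1n mul1r /lincomb.
  by congr rep_diag; ring.
- rewrite norm3_conj in ge.
  have [r [t [n' [k' [lr lt E Hrt]]]]] := reduce n k ge.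
  apply/of_diag; rewrite E conj3D; apply: rep_diag_cat.
    apply: rep_diag_mem; rewrite mem_filter; apply/andP; split.
      apply/asboolP; case: Hrt => [[-> ->]|]; last first.
        move=> le; apply: large; rewrite ?norm3_conj //.
        apply/totpos_conj/totpos_lincomb.
        by apply: lt_le_trans le; apply: le_lt_trans m_gt; apply: ltW.
      split; rewrite ?norm3_conj //.
        by apply/totpos_conj/totpos_lincomb/(lt_le_trans nx0).
      by move/sqclass_sym.
    rewrite mem_cat; apply/orP; right; apply: map_f.
    by apply/allpairsP; exists (r, t); rewrite !mem_iota.
  have := diag_mU epsbar n' k'; congr rep_diag.
  rewrite conj3M /lincomb conj3D conj3M !natz3.
  by apply: z3_ext => /=; ring.
Qed.

(** A lattice that misses something misses an element of minimal norm, which is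
    then exceptional.  Conversely, the lattice missing only the class of an
    exceptional element shows that this class is in every criterion set. *)
Theorem exceptional_criterion (F : lattice_family) :
  diag_closed F ->
  (forall (L : lmodType zsqrt3) (Q : L -> zsqrt3),
     F L Q -> classical_lattice Q) ->
  minimal_criterion_set F totally_positive (exceptional F).
Proof.
move=> Fext Fcl; split.
  split; [split|by move=> x []|].
  - by move=> x [].
  - move=> x y xy [py [L [Q [FQ rep]]]]; split; first exact: sqclass_totpos py.
    exists L, Q; split=> // z pz; rewrite rep //.
    split=> H zc; apply: H; first exact: sqclass_trans zc xy.
    by apply: sqclass_trans zc _; apply: sqclass_sym.
  - move=> L Q FQ; split=> [H x [px _]|H]; first exact: H.
    have below k : forall x, (`|norm3 x| < k)%N -> totally_positive x ->
        represents Q x.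
      elim: k => // k IHk x ltk px; apply: contrapT => nrx; apply: (nrx).
      apply/H/(exceptional_of_minimal Fext Fcl FQ px nrx).
      move=> y py lt; apply: IHk => //; have := totpos_norm py.
      by move: lt ltk; lia.
    by move=> x px; apply: (below (`|norm3 x|).+1).
move=> A [[Apos Acl] _ crit] x [px [L [Q [FQ rep]]]]; apply: contrapT => nAx.
have [_ H] := crit L Q FQ.
have /H/(_ x px)/(rep x px) : universal_for A Q.
  move=> y Ay; apply/rep; first exact: Apos.
  by move=> yx; apply: nAx; apply: (Acl _ y) => //; apply: sqclass_sym.
by apply; apply: sqclass_refl.
Qed.

Lemma the_criterion_setE (F : lattice_family) (S A : set zsqrt3) :
  minimal_criterion_set F S A -> the_criterion_set F S = A.
Proof.
move=> minA; apply: xget_unique => // B [critB minB].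
by case: minA => critA minA; apply/seteqP; split; [apply: minB|apply: minA].
Qed.

Lemma Ccl_exceptional : Ccl = exceptional (@classical_lattice).
Proof.
apply/the_criterion_setE/exceptional_criterion => // L Q d.
exact: classical_ext.
Qed.

Lemma Cdiag_exceptional : Cdiag = exceptional (@diagonal_lattice).
Proof.
apply/the_criterion_setE/exceptional_criterion; last by move=> L Q [].
by move=> L Q d; apply: diagonal_ext.
Qed.

(** * The ten classes are exceptional *)

Fixpoint misses (s : seq zsqrt3) (x : zsqrt3) : bool :=
  if s is d :: s' then all_decompositions 6 d x (fun _ y => misses s' y)
  else x != 0.

Lemma missesP (s : seq zsqrt3) x :
  (forall d, d \in s -> totally_positive d) -> misses s x -> ~ rep_diag s x.
Proof.
elim: s x => [|d s IHs] x ps /=; first by move/eqP.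
move=> H [a [y [xE ry]]].
have {}IHs : misses s y -> ~ rep_diag s y.
  by apply: IHs => c cs; apply: ps; rewrite inE cs orbT.
apply: IHs (ry); apply: (all_decompositionsP H _ xE).
  by apply: ps; rewrite mem_head.
by apply: rep_diag_psd ry => c cs; apply: ps; rewrite inE cs orbT.
Qed.

Fixpoint find_first (T : Type) (P : T -> bool) (s : seq T) : bool :=
  if s is x :: s' then if P x then true else find_first P s' else false.

Lemma find_firstP (T : Type) (P : T -> bool) s :
  find_first P s -> exists x, P x.
Proof. by elim: s => //= x s IHs; case: ifP => [Px _|_ /IHs //]; exists x. Qed.

Fixpoint hits (s : seq zsqrt3) (x : zsqrt3) : bool :=
  if s is d :: s' then
    find_first (fun a => let y := x - d * a ^+ 2 in
                  if psdb y then hits s' y else false) (box 4)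
  else x == 0.

Lemma hitsP (s : seq zsqrt3) x : hits s x -> rep_diag s x.
Proof.
elim: s x => [x /eqP //|d s IHs] x H.
have [a /=] := find_firstP (H : find_first _ _).
by case: ifP => // _ /IHs ry; exists a, (x - d * a ^+ 2); rewrite addrC subrK.
Qed.

(** The test that [x] is an element of minimal norm among those missed by the
    diagonal lattice with entries [s].  As the norm of [lincomb n k] is at least
    [n ^ 2] and [k ^ 2], coordinates below 7 exhaust the norms below 49. *)
Definition truant (s : seq zsqrt3) (x : zsqrt3) : bool :=
  [&& all totposb s, totposb x, misses s x, norm3 x < 49 &
    all (fun n => all (fun k =>
      if 0 < norm3 (lincomb n k) then
        if norm3 (lincomb n k) < norm3 x then
          hits s (lincomb n k) && hits s (conj3 (lincomb n k))
        else true
      else true) (iota 0 7)) (iota 0 7)].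

Lemma exceptional_truant (s : seq zsqrt3) x :
  truant s x -> exceptional (@diagonal_lattice) x.
Proof.
move=> /and5P[/allP ps /totposP px mx bound H].
have {}ps d : d \in s -> totally_positive d by move/ps/totposP.
have ext : diag_closed (@diagonal_lattice).
  by move=> L Q d; apply: diagonal_ext.
have [L [Q [dQ rep]]] := diag_extension ext zero_lattice ps.
have {}rep y : represents Q y <-> rep_diag s y.
  rewrite rep; split=> [[_ [z [-> rz]]]|ry]; first by rewrite add0r.
  by exists 0, y; rewrite add0r.
apply: (exceptional_of_minimal ext _ dQ px); first by move=> L' Q' [].
  by rewrite rep; apply: missesP.
have small n k : norm3 (lincomb n k) < norm3 x -> (n < 7)%N /\ (k < 7)%N.
  by rewrite norm3_lincomb => lt; split; nia.
have both n k : 0 < norm3 (lincomb n k) -> norm3 (lincomb n k) < norm3 x ->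
    hits s (lincomb n k) && hits s (conj3 (lincomb n k)).
  move=> pos lt; have [n7 k7] := small n k lt.
  have nin : n \in iota 0 7 by rewrite mem_iota.
  have kin : k \in iota 0 7 by rewrite mem_iota.
  by have := allP (allP H n nin) k kin; rewrite pos lt.
move=> y py; move: (totpos_norm py); move: y py.
apply: totpos_ind => [y z yz Hz|n k pos lt|n k].
- rewrite (sqclass_norm yz) => pos lt.
  by apply: (represents_sqclass (proj1 dQ) yz); apply: Hz.
- by apply/rep/hitsP; case/andP: (both n k pos lt).
- rewrite norm3_conj => pos lt.
  by apply/rep/hitsP; case/andP: (both n k pos lt).
Qed.

Lemma exceptional_sqclass (F : lattice_family) x y :
  sqclass_eq x y -> exceptional F y -> exceptional F x.
Proof.
move=> xy [py [L [Q [FQ rep]]]]; split; first exact: sqclass_totpos py.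
exists L, Q; split=> // z pz; rewrite rep //.
split=> H zc; apply: H; first exact: sqclass_trans zc xy.
by apply: sqclass_trans zc _; apply: sqclass_sym.
Qed.

(** Lattices with a class of [C] as their truant: the zero lattice, then
    [<1, eps>], then [<1, eps, 1 + eps>] with entries of norm 13 added to it,
    and the conjugate of the latter. *)
Definition truants : seq (seq zsqrt3 * zsqrt3) :=
  [seq ([::], x) | x <- [:: 1; eps]] ++
  [seq ([:: 1; eps], x) |
    x <- [:: 4 + sqrt3; 4 - sqrt3; 5 + 2 * sqrt3; 5 - 2 * sqrt3]] ++
  [seq ([:: 1; eps; 1 + eps; 4 - sqrt3; 5 - 2 * sqrt3], x) |
    x <- [:: 7 + 2 * sqrt3; 8 + 3 * sqrt3]] ++
  [seq ([:: 1; eps; 1 + epsbar; 4 + sqrt3; 5 + 2 * sqrt3], x) |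
    x <- [:: 7 - 2 * sqrt3; 8 - 3 * sqrt3]].

Lemma C_exceptional x : C x -> exceptional (@diagonal_lattice) x.
Proof.
have sub : sub_classes_test C_reps (unzip2 truants) by vm_compute.
move=> /(sub_classes sub)[y /mapP[[s z] sz ->] xz].
apply: (exceptional_sqclass xz); apply: (@exceptional_truant s).
have /allP/(_ _ sz) : all (fun t => truant t.1 t.2) truants by vm_compute.
by [].
Qed.

(** * Verification of the ternary and quaternary forms for bounded norms *)

Local Arguments int_of_Z : simpl never.
Local Arguments Z.mul : simpl never.

(** Elements are represented by pairs of binary integers, in the basis
    [1, sqrt3] ([of_pair]) for multiplications and in the basis [1, eps]
    ([cone]) for the verification, where the elements to be represented are
    those with nonnegative coordinates. *)
Definition of_pair (x : Z * Z) : zsqrt3 :=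
  ZSqrt3 (int_of_Z x.1) (int_of_Z x.2).

Definition pair_add (x y : Z * Z) : Z * Z := (Z.add x.1 y.1, Z.add x.2 y.2).

Definition pair_mul (x y : Z * Z) : Z * Z :=
  (Z.add (Z.mul x.1 y.1) (Z.mul (Zpos 3) (Z.mul x.2 y.2)),
   Z.add (Z.mul x.1 y.2) (Z.mul x.2 y.1)).

Definition pair_sqr (x : Z * Z) : Z * Z := pair_mul x x.

Definition to_cone (x : Z * Z) : Z * Z := (Z.sub x.1 (Z.mul (Zpos 2) x.2), x.2).

Definition cone (n k : Z) : zsqrt3 :=
  of_pair (Z.add n (Z.mul (Zpos 2) k), k).

Lemma int_of_ZD (x y : Z) : int_of_Z (Z.add x y) = int_of_Z x + int_of_Z y.
Proof. exact: (rmorphD int_of_Z). Qed.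

Lemma int_of_ZM (x y : Z) : int_of_Z (Z.mul x y) = int_of_Z x * int_of_Z y.
Proof. exact: (rmorphM int_of_Z). Qed.

Lemma int_of_ZN (x : Z) : int_of_Z (Z.opp x) = - int_of_Z x.
Proof. exact: (rmorphN int_of_Z). Qed.

Lemma int_of_ZB (x y : Z) : int_of_Z (Z.sub x y) = int_of_Z x - int_of_Z y.
Proof. exact: (rmorphB int_of_Z). Qed.

Lemma int_of_Z_const :
  (int_of_Z (Zpos 2) = 2) * (int_of_Z (Zpos 3) = 3) * (int_of_Z (Zpos 4) = 4).
Proof. by []. Qed.

Definition int_of_ZE :=
  (int_of_ZD, int_of_ZM, int_of_ZN, int_of_ZB, int_of_Z_const).

Lemma of_pairD (x y : Z * Z) :
  of_pair (pair_add x y) = of_pair x + of_pair y.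
Proof. by apply: z3_ext; rewrite /= !int_of_ZE. Qed.

Lemma of_pairM (x y : Z * Z) :
  of_pair (pair_mul x y) = of_pair x * of_pair y.
Proof. by apply: z3_ext; rewrite /= !int_of_ZE. Qed.

Lemma of_pair_sqr (x : Z * Z) : of_pair (pair_sqr x) = of_pair x ^+ 2.
Proof. exact: of_pairM. Qed.

Lemma to_coneK (x : Z * Z) : cone (to_cone x).1 (to_cone x).2 = of_pair x.
Proof. by rewrite /cone /= Z.sub_add; case: x. Qed.

Lemma coneD (n k n' k' : Z) :
  cone n k + cone n' k' = cone (Z.add n n') (Z.add k k').
Proof. by rewrite /cone -of_pairD; congr of_pair; congr pair => /=; lia. Qed.

Lemma lincomb_cone (n k : nat) : lincomb n k = cone (Z.of_nat n) (Z.of_nat k).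
Proof.
rewrite lincombE /cone /of_pair /= !int_of_ZE.
by congr (ZSqrt3 (_ + _ * _)); lia.
Qed.

Definition to_pair (x : zsqrt3) : Z * Z :=
  (Z_of_int (ratp x), Z_of_int (irrp x)).

Lemma to_pairK : cancel to_pair of_pair.
Proof. by case=> a b; rewrite /of_pair /= !Z_of_intK. Qed.

Definition zkey (z : Z) : positive :=
  match z with Z0 => xH | Zpos p => xO p | Zneg p => xI p end.

Lemma zkey_inj : injective zkey.
Proof. by case=> [|p|p] [|q|q] //= [->]. Qed.

Fixpoint zrange (lo : Z) (m : nat) : seq Z :=
  if m is m'.+1 then lo :: zrange (Z.succ lo) m' else [::].

Lemma mem_zrange (lo z : Z) (m : nat) :
  Z.le lo z -> Z.lt z (Z.add lo (Z.of_nat m)) -> z \in zrange lo m.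
Proof.
elim: m lo => [|m IHm] lo le lt; first by lia.
rewrite inE; have [//|/eqP ne /=] := eqVneq z lo; apply: IHm; lia.
Qed.

Definition zbound : Z := Z.mul (Zpos 250) (Z.pow (Zpos 10) (Zpos 3)).

(** The norm of [cone n k] is [(n + 2 * k) ^ 2 - 3 * k ^ 2]; for a fixed [k], it
    is at most [zbound] when the natural number [n] is at most this value. *)
Definition row_length (k : Z) : Z :=
  Z.sub (Z.sqrt (Z.add zbound (Z.mul (Zpos 3) (Z.mul k k)))) (Z.mul (Zpos 2) k).

Definition margin : Z := Zpos 30.

(** The norm of a sum is at least that of its terms: a representation of an
    element of norm at most [zbound] involves only elements whose norm is at
    most the square root of [zbound], i.e., 500. *)
Definition useful (x : Z * Z) : bool :=
  Z.leb (Z.abs (Z.sub (Z.mul x.1 x.1) (Z.mul (Zpos 3) (Z.mul x.2 x.2))))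
    (Zpos 501).

Definition multiples (d : Z * Z) (M : Z) (s : seq (Z * Z)) : seq (Z * Z) :=
  [seq x <- [seq pair_mul d (pair_sqr x) | x <- s] | Z.leb x.1 M].

(** The region to be covered consists of elements whose rational part is at most
    1000; the bound 1050 on the values leaves a margin, and the ranges contain
    all the [x] such that [x ^+ 2] or [eps * x ^+ 2] is below it, up to sign. *)
Definition pairs_up_to_sign : seq (Z * Z) :=
  [seq x <- [seq (p, q) | p <- zrange Z0 46, q <- zrange (Zneg 27) 55]
     | useful x].

Definition squares : seq (Z * Z) :=
  map to_cone (multiples (Zpos 1, Z0) (Zpos 1050) pairs_up_to_sign).

Definition eps_squares : seq (Z * Z) :=
  map to_cone (multiples (Zpos 2, Zpos 1) (Zpos 1050) pairs_up_to_sign).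

Definition rows_of (T : Type) (m : PositiveMap.t (seq T)) (k : Z) : seq T :=
  if PositiveMap.find (zkey k) m is Some l then l else [::].

Fixpoint group_rows (l : seq (Z * Z)) : PositiveMap.t (seq Z) :=
  if l is (n, k) :: l' then
    let m := group_rows l' in
    PositiveMap.add (zkey k) (n :: rows_of m k) m
  else PositiveMap.empty _.

Fixpoint add_row (n top : Z) (l : seq Z) (s : PositiveSet.t) : PositiveSet.t :=
  if l is n' :: l' then
    let t := Z.add n n' in
    if Z.ltb t (Z.opp margin) then add_row n top l' s
    else if Z.ltb top t then add_row n top l' s
    else add_row n top l' (PositiveSet.add (zkey t) s)
  else s.

Fixpoint sum_row (m : PositiveMap.t (seq Z)) (k top : Z) (l : seq (Z * Z))
    (s : PositiveSet.t) : PositiveSet.t :=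
  if l is (n, k') :: l' then
    match PositiveMap.find (zkey (Z.sub k k')) m with
    | Some r => sum_row m k top l' (add_row n top r s)
    | None => sum_row m k top l' s
    end
  else s.

Fixpoint sum_rows (m : PositiveMap.t (seq Z)) (l : seq (Z * Z)) (ks : seq Z) :
    PositiveMap.t PositiveSet.t :=
  if ks is k :: ks' then
    PositiveMap.add (zkey k)
      (sum_row m k (Z.add (row_length k) margin) l PositiveSet.empty)
      (sum_rows m l ks')
  else PositiveMap.empty _.

(** The table of the values of [<1, eps>]: the row [k] holds the [n] such that
    [cone n k] is such a value.  It covers the elements [cone n k] with
    [n, k >= 0] and norm at most [zbound], with a margin since the quantities
    subtracted from them below have coordinates of both signs. *)
Definition sum_sets : PositiveMap.t PositiveSet.t :=
  sum_rows (group_rows eps_squares) squares (zrange (Z.opp margin) 561).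

Definition is_sum (x : zsqrt3) : Prop := exists a b, x = a ^+ 2 + eps * b ^+ 2.

Lemma multiplesP (d x : Z * Z) M s :
  x \in map to_cone (multiples d M s) ->
  exists a, cone x.1 x.2 = of_pair d * a ^+ 2.
Proof.
move=> /mapP[y + ->]; rewrite mem_filter => /andP[_ /mapP[z _ ->]].
by exists (of_pair z); rewrite to_coneK of_pairM of_pair_sqr.
Qed.

Lemma squaresP (n k : Z) : (n, k) \in squares -> exists a, cone n k = a ^+ 2.
Proof.
rewrite /squares; move: pairs_up_to_sign => s /multiplesP[a ->]; exists a.
by have -> : of_pair (Zpos 1, Z0) = 1 by []; rewrite mul1r.
Qed.

Lemma eps_squaresP (n k : Z) :
  (n, k) \in eps_squares -> exists a, cone n k = eps * a ^+ 2.
Proof.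
rewrite /eps_squares; move: pairs_up_to_sign => s /multiplesP[a ->]; exists a.
by have -> : of_pair (Zpos 2, Zpos 1) = eps by [].
Qed.

Lemma group_rowsP (l : seq (Z * Z)) (n k : Z) :
  n \in rows_of (group_rows l) k -> (n, k) \in l.
Proof.
elim: l => [|[n' k'] l IHl] /=; first by rewrite /rows_of PositiveMap.gempty.
rewrite inE xpair_eqE; have [e|ne] := eqVneq k k'.
  rewrite -{}e {1}/rows_of PositiveMap.gss inE andbT => /orP[->//|/IHl ->].
  by rewrite orbT.
rewrite {1}/rows_of PositiveMap.gso => [|/zkey_inj e]; last first.
  by rewrite e eqxx in ne.
by move/IHl ->; rewrite orbT.
Qed.

Definition row_correct (k : Z) (s : PositiveSet.t) : Prop :=
  forall n, PositiveSet.mem (zkey n) s -> is_sum (cone n k).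

Lemma sum_row_correct (m : PositiveMap.t (seq Z)) (k top : Z) l s :
  (forall n k', n \in rows_of m k' -> exists b, cone n k' = eps * b ^+ 2) ->
  (forall n k', (n, k') \in l -> exists a, cone n k' = a ^+ 2) ->
  row_correct k s -> row_correct k (sum_row m k top l s).
Proof.
move=> Hm; elim: l s => // [[n k'] l IHl] s Hl Hs /=.
have {}IHl s' : row_correct k s' -> row_correct k (sum_row m k top l s').
  by apply: IHl => n1 k1 ?; apply: Hl; rewrite inE; apply/orP; right.
have [a Ea] : exists a, cone n k' = a ^+ 2 by apply: Hl; rewrite mem_head.
case E: (PositiveMap.find _ m) => [r|]; apply: IHl => //.
have {E}Hr b : b \in r -> is_sum (cone (Z.add n b) k).
  move=> br; have [|c Ec] := Hm b (Z.sub k k'); first by rewrite /rows_of E.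
  exists a, c; rewrite -Ea -Ec coneD; congr cone; lia.
elim: r s Hr Hs => //= b r IHr s Hr Hs.
have {}IHr s' : row_correct k s' -> row_correct k (add_row n top r s').
  by apply: IHr => b' ?; apply: Hr; rewrite inE; apply/orP; right.
case: ifP => _; first exact: IHr.
case: ifP => _; first exact: IHr.
apply: IHr => n1 /PositiveSet.mem_spec/PositiveSet.add_spec[/zkey_inj->|].
  by apply: Hr; rewrite mem_head.
by move/PositiveSet.mem_spec; apply: Hs.
Qed.

Lemma sum_rows_correct (m : PositiveMap.t (seq Z)) l ks (k : Z) s :
  (forall n k', n \in rows_of m k' -> exists b, cone n k' = eps * b ^+ 2) ->
  (forall n k', (n, k') \in l -> exists a, cone n k' = a ^+ 2) ->
  PositiveMap.find (zkey k) (sum_rows m l ks) = Some s -> row_correct k s.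
Proof.
move=> Hm Hl; elim: ks => [|k' ks IHks] /=; first by rewrite PositiveMap.gempty.
have [e|ne] := eqVneq k k'; last first.
  rewrite PositiveMap.gso => [|/zkey_inj e]; last by rewrite e eqxx in ne.
  exact: IHks.
rewrite -{}e PositiveMap.gss => -[<-]; exact: sum_row_correct.
Qed.

Lemma sum_setsP (k : Z) s :
  PositiveMap.find (zkey k) sum_sets = Some s -> row_correct k s.
Proof.
apply: sum_rows_correct; first by move=> n k1 /group_rowsP/eps_squaresP.
by move=> n k1 /squaresP.
Qed.

Fixpoint hit (n : Z) (rows : seq (Z * PositiveSet.t)) : bool :=
  if rows is (u, s) :: rows' then
    if PositiveSet.mem (zkey (Z.sub n u)) s then true else hit n rows'
  else false.

Definition shifted_rows (T : PositiveMap.t PositiveSet.t) (k : Z)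
    (vals : seq (Z * Z)) : seq (Z * PositiveSet.t) :=
  pmap (fun v => omap (pair v.1) (PositiveMap.find (zkey (Z.sub k v.2)) T))
    vals.

(** The test that every [cone n k] in the region, but those in [exc], is the
    sum of a value of [<1, eps>] and one of the elements of [vals]. *)
Definition covers (T : PositiveMap.t PositiveSet.t) (vals : seq (Z * Z))
    (exc : seq zsqrt3) : bool :=
  all (fun k => let rows := shifted_rows T k (map to_cone vals) in
    all (fun n => if hit n rows then true else cone n k \in exc)
      (zrange Z0 (Z.to_nat (Z.succ (row_length k))))) (zrange Z0 501).

(** The values of a quadratic form, with the small ones first: most elements
    are then settled after very few trials. *)
Definition small_values (M : Z) (s : seq (Z * Z)) : seq (Z * Z) :=
  sort (fun x y => Z.leb x.1 y.1) (undup [seq x <- s | Z.leb x.1 M]).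

Definition pair_box (R : nat) : seq (Z * Z) :=
  let r := zrange (Z.opp (Z.of_nat R)) (R + R).+1 in
  [seq (p, q) | p <- r, q <- r].

Definition ternary_values (d : Z * Z) : seq (Z * Z) :=
  small_values (Zpos 300) [seq pair_mul d (pair_sqr c) | c <- pair_box 10].

Definition binary_values (p a q : Z * Z) : seq (Z * Z) :=
  small_values (Zpos 40)
    [seq pair_add (pair_mul p (pair_sqr s))
           (pair_add (pair_mul (pair_add a a) (pair_mul s t))
                     (pair_mul q (pair_sqr t)))
       | s <- pair_box 3, t <- pair_box 3].

(** The verification runs over the elements [cone n k]; for their conjugates, it
    is the conjugate form that is checked. *)
Definition ternary_checks : seq (zsqrt3 * seq zsqrt3) :=
  [:: (1, [::]);
      (1 + eps, ternary_exceptions);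
      (1 + epsbar, [seq conj3 x | x <- ternary_exceptions])].

Definition quaternary_checks : seq zsqrt3 :=
  [:: 0; 1; 2; sqrt3; 1 + sqrt3; 1 - sqrt3].

Definition all_covered : bool :=
  let T := sum_sets in
  all (fun c => covers T (ternary_values (to_pair c.1)) c.2) ternary_checks &&
  all (fun a => covers T (binary_values (to_pair (2 + eps)) (to_pair a)
                            (to_pair (2 + epsbar))) quaternary_exceptions)
    quaternary_checks.

Lemma all_coveredT : all_covered.
Proof. by vm_compute. Qed.

Lemma hit_shifted_rows (T : PositiveMap.t PositiveSet.t) (n k : Z) vals :
  hit n (shifted_rows T k vals) -> exists2 v, v \in vals &
    exists2 s, PositiveMap.find (zkey (Z.sub k v.2)) T = Some s
             & PositiveSet.mem (zkey (Z.sub n v.1)) s.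
Proof.
elim: vals => // v vals IH; rewrite /shifted_rows /=.
have next : hit n (shifted_rows T k vals) -> exists2 w, w \in v :: vals &
    exists2 s, PositiveMap.find (zkey (Z.sub k w.2)) T = Some s
             & PositiveSet.mem (zkey (Z.sub n w.1)) s.
  by move=> /IH[w wv H]; exists w => //; rewrite inE wv orbT.
case E: (PositiveMap.find _ T) => [s|] //=; case: ifP => // hit_s _.
by exists v; [rewrite mem_head|exists s].
Qed.

Lemma coversP vals exc (n k : nat) : covers sum_sets vals exc ->
  norm3 (lincomb n k) <= norm_bound -> lincomb n k \notin exc ->
  exists2 v, v \in vals & exists a b,
    lincomb n k = a ^+ 2 + eps * b ^+ 2 + of_pair v.
Proof.
rewrite norm3_lincomb => cov bound nexc.
have {}bound : Z.le (Z.add (Z.mul (Z.of_nat n) (Z.of_nat n))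
    (Z.add (Z.mul (Zpos 4) (Z.mul (Z.of_nat n) (Z.of_nat k)))
       (Z.mul (Z.of_nat k) (Z.of_nat k)))) zbound.
  have zE : zbound = Zpos 250000 by [].
  have bE : norm_bound = 250 * (10 * (10 * 10)).
    by rewrite /norm_bound !exprS expr0 mulr1.
  by move: bound; rewrite zE bE; lia.
have kin : Z.of_nat k \in zrange Z0 501.
  apply: mem_zrange; first by lia.
  by move: bound; have -> : zbound = Zpos 250000 by []; nia.
have nin : Z.of_nat n \in
    zrange Z0 (Z.to_nat (Z.succ (row_length (Z.of_nat k)))).
  apply: mem_zrange; first by lia.
  suff : Z.le (Z.of_nat n) (row_length (Z.of_nat k)) by lia.
  suff : Z.le (Z.add (Z.of_nat n) (Z.mul (Zpos 2) (Z.of_nat k)))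
    (Z.sqrt (Z.add zbound (Z.mul (Zpos 3) (Z.mul (Z.of_nat k) (Z.of_nat k))))).
    by move/Z.le_add_le_sub_r.
  apply/Z.sqrt_le_square; [|by lia|by move: bound; move: zbound => B; nia].
  have := Z.square_nonneg (Z.of_nat k); have -> : zbound = Zpos 250000 by [].
  by move: (Z.mul _ (Z.of_nat k)) => r; lia.
have := allP (allP cov _ kin) _ nin; case: ifP => [hit_nk _|_].
  have [v /mapP[w wv ->] [s find_s mem_s]] := hit_shifted_rows hit_nk.
  exists w => //; have [a [b E]] := sum_setsP find_s mem_s; exists a, b.
  by rewrite -E lincomb_cone -to_coneK coneD !Z.sub_add.
by rewrite -lincomb_cone (negPf nexc).
Qed.

Lemma mem_small_values M s v : v \in small_values M s -> v \in s.
Proof. by rewrite mem_sort mem_undup mem_filter => /andP[]. Qed.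

Lemma covers_rep3 d exc (n k : nat) : (d, exc) \in ternary_checks ->
  norm3 (lincomb n k) <= norm_bound -> lincomb n k \notin exc ->
  rep3 d (lincomb n k).
Proof.
move=> din bound nexc; have /andP[/allP/(_ _ din) cov _] := all_coveredT.
have [v /mem_small_values/mapP[c _ ->] [a [b ->]]] := coversP cov bound nexc.
by exists a, b, (of_pair c); rewrite of_pairM of_pair_sqr to_pairK.
Qed.

Lemma covers_rep4 a (n k : nat) :
  (a \in quaternary_checks) || (- a \in quaternary_checks) ->
  norm3 (lincomb n k) <= norm_bound ->
  lincomb n k \notin quaternary_exceptions ->
  rep4 (2 + eps) a (2 + epsbar) (lincomb n k).
Proof.
move=> ain bound nexc; have /andP[_ /allP allq] := all_coveredT.
have one c : c \in quaternary_checks ->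
    rep4 (2 + eps) c (2 + epsbar) (lincomb n k).
  move=> /allq cov.
  have [v /mem_small_values/allpairsP[[s t] [_ _ ->]] [x [y ->]]] :=
    coversP cov bound nexc.
  exists x, y, (of_pair s), (of_pair t).
  rewrite !(of_pairD, of_pairM, of_pair_sqr, to_pairK) /=.
  rewrite -mulr2n -[c *+ 2]mulr_natl.
  by rewrite (addrA (_ * of_pair s ^+ 2)).
by case/orP: ain => /one // /rep4_opp.
Qed.

Lemma form_facts_bounded : form_facts (fun m => m <= norm_bound).
Proof.
have classes_inv s x y : sqclass_eq x y -> ~ classes_of s x -> ~ classes_of s y.
  by move=> xy nx [z zs yz]; apply: nx; exists z => //; apply: sqclass_trans yz.
have notin s x : ~ classes_of s x -> x \notin s.
  move=> nx; apply/negP => xs; apply: nx.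
  by exists x => //; apply: sqclass_refl.
split.
- by move=> m n _ mn /(le_trans mn).
- apply: totpos_ind => [x y xy H|n k b|n k].
  + by rewrite (sqclass_norm xy) => /H; apply: rep3_sqclass.
  + by apply: (@covers_rep3 _ [::]).
  + rewrite norm3_conj => b; have {1}-> : 1 = conj3 1 by [].
    by apply/rep3_conj/(@covers_rep3 _ [::]).
- apply: totpos_ind => [x y xy H|n k b|n k].
  + rewrite (sqclass_norm xy) => /H {}H /(classes_inv _ _ _ xy)/H.
    exact: rep3_sqclass.
  + by move/notin; apply: covers_rep3 => //; vm_compute.
  + rewrite norm3_conj => b /notin nx.
    have -> : 1 + eps = conj3 (1 + epsbar) by apply: z3_ext.
    apply/rep3_conj/(@covers_rep3 _ [seq conj3 y | y <- ternary_exceptions]).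
    * by vm_compute.
    * exact: b.
    * by apply: contra nx => /mapP[y ys ->]; rewrite conj3K.
- move=> a aL; apply: totpos_ind => [x y xy H|n k b|n k].
  + rewrite (sqclass_norm xy) => /H {}H /(classes_inv _ _ _ xy)/H.
    exact: rep4_sqclass.
  + move/notin; apply: covers_rep4 b.
    by move: a aL; apply/allP; vm_compute.
  + rewrite norm3_conj => b /notin nx.
    suff : rep4 (conj3 (2 + epsbar)) (conj3 (conj3 a)) (conj3 (2 + eps))
        (conj3 (lincomb n k)) by rewrite conj3K.
    apply: rep4_conj; rewrite conj3K.
    apply: (covers_rep4 _ b); last first.
      apply: contra nx => ln.
      have : all (fun y => conj3 y \in quaternary_exceptions)
        quaternary_exceptions by vm_compute.
      by move/allP/(_ _ ln).
    by move: a aL; apply/allP; vm_compute.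
Qed.

Theorem theorem6p2 :
  [/\ (* the ten listed elements lie in ten distinct classes *)
      forall i j : nat, (i < 10)%N -> (j < 10)%N ->
        sqclass_eq C_reps`_i C_reps`_j -> i = j,
      C `<=` Cdiag /\ Cdiag `<=` Ccl,
      forall x : zsqrt3, Ccl x -> norm3 x < norm_bound -> C x,
      minimal_criterion_set (@classical_lattice) S_bounded C
    & hypothesis_A -> hypothesis_B -> Ccl = C /\ Cdiag = C].
Proof.
have C_diag : C `<=` Cdiag by rewrite Cdiag_exceptional => x /C_exceptional.
have diag_cl : Cdiag `<=` Ccl.
  rewrite Cdiag_exceptional Ccl_exceptional => x [px [L [Q [[cl _] rep]]]].
  by split=> //; exists L, Q.
have C_class : class_set C.
  split.
    move=> x /C_diag/diag_cl; rewrite Ccl_exceptional; by case.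
  by move=> x y xy [z zC yz]; exists z => //; apply: sqclass_trans yz.
have Ccl_sub bd : form_facts bd -> forall x, Ccl x -> bd (norm3 x) -> C x.
  move=> ff x; rewrite Ccl_exceptional => -[px [L [Q [cl rep]]]] bx.
  apply: contrapT => nC; have [H _] := rep x px; apply: H (sqclass_refl x).
  apply: (universal_of_C ff cl) => // y Cy; apply/rep.
    by case: C_class => Cpos _; apply: Cpos.
  by move=> yx; apply: nC; case: C_class => _; apply; last exact: Cy;
    apply: sqclass_sym.
have C_bound x : C x -> norm3 x <= norm_bound.
  move=> [y yC /sqclass_norm ->].
  have /allP/(_ y yC) le49 : all (fun y => norm3 y < 49) C_reps by vm_compute.
  apply/ltW/(lt_le_trans le49); rewrite /norm_bound !exprS expr0 mulr1.
  by lia.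
split.
- move=> i j li lj /sqclass_testP.
  have /allP/(_ i) : all (fun i => all (fun j =>
    sqclass_test C_reps`_i C_reps`_j ==> (i == j)) (iota 0 10)) (iota 0 10).
    by vm_compute.
  rewrite mem_iota => /(_ li)/allP/(_ j); rewrite mem_iota => /(_ lj)/implyP.
  by move=> H /H/eqP.
- by [].
- by move=> x Cx lt; apply: (Ccl_sub _ form_facts_bounded) => //; apply: ltW.
- split.
    split=> // [x Cx|L Q cl].
      by split; [case: C_class => Cpos _; apply: Cpos|apply: C_bound].
    split=> [H x Cx|H x [px bx]].
      apply: H; split; last exact: C_bound.
      by case: C_class => Cpos _; apply: Cpos.
    exact: (universal_of_C form_facts_bounded cl).
  move=> A [[_ Acl] AS crit] x Cx; have := diag_cl _ (C_diag _ Cx).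
  rewrite Ccl_exceptional => -[px [L [Q [cl rep]]]]; apply: contrapT => nAx.
  have [_ H] := crit L Q cl.
  have Sx : S_bounded x by split; [|apply: C_bound].
  have : represents Q x.
    apply: H Sx => y Ay; apply/rep; first by case: (AS _ Ay).
    by move=> yx; apply: nAx; apply: (Acl _ y) => //; apply: sqclass_sym.
  by move/(rep x px); apply; apply: sqclass_refl.
- move=> hA hB; have ff := form_facts_of_hypotheses hA hB.
  have cl_C : Ccl `<=` C by move=> x Cx; apply: (Ccl_sub _ ff).
  by split; apply/seteqP; split=> // x; [move/C_diag/diag_cl|move/diag_cl/cl_C].
Qed.
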